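(* Let $(A,m,1,*,\Delta,\varepsilon,S)$ be a finite C$^*$-quantum groupoid and let $k$ be the positive invertible element of $A_t$ with $k^2=1_{(2)}S(1_{(1)})$. Define, for $a\in A$, $$\tilde\Delta(a)=(1\otimes k^{-1})\Delta(a)(1\otimes k^{-1}),\quad \tilde\varepsilon(a)=\varepsilon(kaS(k))=\varepsilon(S(k)ak),\quad \tilde S(a)=S(k^{-1})\,k\,S(a)\,k^{-1}\,S(k).$$ Then $(A,m,1,*,\tilde\Delta,\tilde\varepsilon,\tilde S)$ is a finite C$^*$-quantum groupoid which is regular (its antipode is involutive on its counital subalgebras); these are exactly the coalgebra structures dual, with respect to the deformed pairing $[a,b]=\langle kaS(k),b\rangle$, to the algebra structure of the dual $B$. Consequently any pair of dual finite C$^*$-quantum groupoids can be deformed into a pair of dual regular finite C$^*$-quantum groupoids without changing the C$^*$-algebra structures.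
   Context: Finite C$^*$-quantum groupoid: a finite-dimensional C$^*$-algebra $G$ (product $m$, unit $1$, involution $*$) with coassociative $*$-homomorphic coproduct $\Delta$ satisfying $(\Delta\otimes\mathrm{id})\Delta(1)=(1\otimes\Delta(1))(\Delta(1)\otimes1)$, counit $\varepsilon$ with $\varepsilon(fgh)=\varepsilon(fg_{(1)})\varepsilon(g_{(2)}h)$, antipode $S$ (algebra and coalgebra anti-homomorphism) with $m(\mathrm{id}\otimes S)\Delta(g)=(\varepsilon\otimes\mathrm{id})(\Delta(1)(g\otimes1))$; Sweedler notation $\Delta(x)=x_{(1)}\otimes x_{(2)}$, $\Delta(1)=1_{(1)}\otimes1_{(2)}$. Counital subalgebras: $A_t=\varepsilon_t(A)$, $A_s=\varepsilon_s(A)$ with $\varepsilon_t(g)=(\varepsilon\otimes\mathrm{id})(\Delta(1)(g\otimes1))$, $\varepsilon_s(g)=(\mathrm{id}\otimes\varepsilon)((1\otimes g)\Delta(1))$. Regular: $S^2$ is the identity on $A_t$ and $A_s$. $B$ is the dual quantum groupoid with pairing $\langle\cdot,\cdot\rangle$ satisfying $\langle a,bc\rangle=\langle\Delta(a),b\otimes c\rangle$. The element $1_{(2)}S(1_{(1)})$ is known to be a positive invertible element of $A_t$; $k$ is its positive square root. *)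

(* Defs.v *)
(* (+ mathcomp-real-closed for R[i], mathcomp-analysis reals for realType). *)
From HB Require Import structures.
From mathcomp Require Import all_boot all_order all_algebra all_field.
From mathcomp Require Import reals complex.
Set Implicit Arguments.
Unset Strict Implicit.
Unset Printing Implicit Defensive.
Import GRing.Theory Num.Theory.
Local Open Scope ring_scope.

(* Algebraic tensor products of finite-dimensional vector spaces, in        *)
(* coordinates w.r.t. the canonical basis  vbasis fullv.                     *)
(*  U (x) V  is represented by  'M[C]_(bdim U, bdim V)  (the coefficient     *)
(*  matrix of  sum_ij X i j  be i (x) be j).                                 *)

Section Tensor.
Variable C : numClosedFieldType.

Definition bdim (V : vectType C) : nat := \dim (fullv : {vspace V}).
Definition be (V : vectType C) (i : 'I_(bdim V)) : V := tnth (vbasis fullv) i.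
Definition crd (V : vectType C) (i : 'I_(bdim V)) (v : V) : C :=
  coord (vbasis fullv) i v.

Notation tensT U V := 'M[C]_(bdim U, bdim V).

(* pure tensor  u (x) v *)
Definition tens (U V : vectType C) (u : U) (v : V) : tensT U V :=
  \matrix_(i, j) (crd i u * crd j v).

(* linear extension of  (u (x) v) |-> phi u v  (phi bilinear into W) *)
Definition tcontract (U V W : vectType C) (phi : U -> V -> W) (X : tensT U V)
  : W := \sum_i \sum_j X i j *: phi (be i) (be j).

(* scalar-valued version:  (u (x) v) |-> phi u v *)
Definition teval (U V : vectType C) (phi : U -> V -> C) (X : tensT U V) : C :=
  \sum_i \sum_j X i j * phi (be i) (be j).

(* f (x) g  for linear f, g *)
Definition tmap (U V U' V' : vectType C) (f : U -> U') (g : V -> V')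
  (X : tensT U V) : tensT U' V' := tcontract (fun u v => tens (f u) (g v)) X.

(* product on U (x) V induced by products mU, mV (bilinear extension) *)
Definition tmul (U V : vectType C) (mU : U -> U -> U) (mV : V -> V -> V)
  (X Y : tensT U V) : tensT U V :=
  \sum_i \sum_j \sum_k \sum_l
     (X i j * Y k l) *: tens (mU (be i) (be k)) (mV (be j) (be l)).

(* involution on U (x) V induced by (antilinear) involutions sU, sV *)
Definition tstar (U V : vectType C) (sU : U -> U) (sV : V -> V)
  (X : tensT U V) : tensT U V :=
  \sum_i \sum_j (X i j)^* *: tens (sU (be i)) (sV (be j)).

(* flip  u (x) v |-> v (x) u *)
Definition tflip (U V : vectType C) (X : tensT U V) : tensT V U :=
  tcontract (fun u v => tens v u) X.

(* associator  U (x) (V (x) W)  -->  (U (x) V) (x) W *)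
Definition tassoc (U V W : vectType C) (X : 'M[C]_(bdim U, bdim (tensT V W)))
  : 'M[C]_(bdim (tensT U V), bdim W) :=
  tcontract (fun u (M : tensT V W) =>
               tcontract (fun v w => tens (tens u v) w) M) X.

(* pairing of tensors induced by a pairing p : U -> V -> C *)
Definition tpair (U V : vectType C) (p : U -> V -> C)
  (X : tensT U U) (Y : tensT V V) : C :=
  \sum_i \sum_j \sum_k \sum_l
     X i j * Y k l * p (be i) (be k) * p (be j) (be l).

End Tensor.

Notation "''T[' C ]_( U , V )" := 'M[C]_(bdim U, bdim V)
  (at level 8, format "''T[' C ]_( U ,  V )") : type_scope.

(* Finite C*-quantum groupoids                                               *)

Section QG.
Variable C : numClosedFieldType.

Definition is_linear (U V : vectType C) (f : U -> V) : Prop :=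
  forall (c : C) (x y : U), f (c *: x + y) = c *: f x + f y.

Definition conj_transpose (N : nat) (M : 'M[C]_N) : 'M[C]_N :=
  (map_mx Num.conj M)^T.

(* A finite-dimensional C*-algebra: a finite-dimensional unital algebra     *)
(* with an involution (antilinear, anti-multiplicative, involutive) that    *)
(* admits a faithful unital *-representation on some C^N, i.e. it is        *)
(* *-isomorphic to a unital *-subalgebra of M_N(C).                          *)
Definition is_fdCstar (A : falgType C) (star : A -> A) : Prop :=
  [/\ forall (c : C) (x y : A), star (c *: x + y) = c^* *: star x + star y,
      forall x y : A, star (x * y) = star y * star x,
      forall x : A, star (star x) = x &
      exists (N : nat) (rho : A -> 'M[C]_N),
        [/\ is_linear (rho : A -> 'M[C]_N), injective rho,
            forall x y : A, rho (x * y) = rho x *m rho y,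
            rho 1 = 1%:M &
            forall x : A, rho (star x) = conj_transpose (rho x)]].

Variable A : falgType C.
Notation AA := 'T[C]_(A, A).
Notation AAA := 'T[C]_(AA, A).

Definition mulT (X Y : AA) : AA := tmul (@GRing.mul A) (@GRing.mul A) X Y.
Definition mulT3 (X Y : AAA) : AAA := tmul mulT (@GRing.mul A) X Y.

(* target and source counital maps *)
Definition eps_t (D : A -> AA) (e : A -> C) (g : A) : A :=
  tcontract (fun x y => e x *: y) (mulT (D 1) (tens g 1)).
Definition eps_s (D : A -> AA) (e : A -> C) (g : A) : A :=
  tcontract (fun x y => e y *: x) (mulT (tens 1 g) (D 1)).

Definition in_At (D : A -> AA) (e : A -> C) (a : A) : Prop :=
  exists g, a = eps_t D e g.
Definition in_As (D : A -> AA) (e : A -> C) (a : A) : Prop :=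
  exists g, a = eps_s D e g.

(* Finite C*-quantum groupoid (weak Hopf C*-algebra) in the sense of        *)
(* Boehm-Nill-Szlachanyi / Nikshych-Vainerman.                               *)
Definition is_CQG (star : A -> A) (D : A -> AA) (e : A -> C) (S : A -> A)
  : Prop :=
  [/\ is_fdCstar star,
      (* comultiplication: linear, coassociative, multiplicative, *-preserving *)
      [/\ is_linear D,
          forall a, tmap D id (D a) = tassoc (tmap id D (D a)),
          forall a b, D (a * b) = mulT (D a) (D b) &
          forall a, D (star a) = tstar star star (D a)],
      (* counit *)
      [/\ is_linear (e : A -> C^o),
          forall a, tcontract (fun x y => e x *: y) (D a) = a,
          forall a, tcontract (fun x y => e y *: x) (D a) = a,
          forall f g h, e (f * g * h) = teval (fun x y => e (f * x) * e (y * h)) (D g) &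
          forall f g h, e (f * g * h) = teval (fun x y => e (f * y) * e (x * h)) (D g)],
      (* weak unit axiom *)
      tmap D id (D 1) = mulT3 (tassoc (tens 1 (D 1))) (tens (D 1) 1) /\
      tmap D id (D 1) = mulT3 (tens (D 1) 1) (tassoc (tens 1 (D 1))) &
      (* antipode *)
      [/\ is_linear S,
          (* algebra anti-homomorphism *)
          S 1 = 1 /\ (forall a b, S (a * b) = S b * S a),
          (* coalgebra anti-homomorphism *)
          (forall a, D (S a) = tflip (tmap S S (D a))) /\ (forall a, e (S a) = e a),
          (forall a, tcontract (fun x y => x * S y) (D a) = eps_t D e a) /\
          (forall a, tcontract (fun x y => S x * y) (D a) = eps_s D e a) &
          forall a, tcontract (fun (M : AA) z =>
                       tcontract (fun x y => S x * y * S z) M) (tmap D id (D a))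
                    = S a]].

(* regular: S^2 is the identity on A_t and A_s *)
Definition is_regular (D : A -> AA) (e : A -> C) (S : A -> A) : Prop :=
  (forall a, in_At D e a -> S (S a) = a) /\
  (forall a, in_As D e a -> S (S a) = a).

(* the deformed structure maps *)
Definition def_Delta (D : A -> AA) (k : A) (a : A) : AA :=
  mulT (tens 1 k^-1) (mulT (D a) (tens 1 k^-1)).
Definition def_eps (e : A -> C) (S : A -> A) (k : A) (a : A) : C :=
  e (k * a * S k).
Definition def_S (S : A -> A) (k : A) (a : A) : A :=
  S k^-1 * k * S a * k^-1 * S k.

End QG.

(* Duality of two finite C*-quantum groupoids A, B w.r.t. a pairing p      *)
(* (Nikshych-Vainerman, dual quantum groupoid).                             *)
Definition is_dual_pair (C : numClosedFieldType) (A B : falgType C)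
  (starA : A -> A) (DA : A -> 'T[C]_(A, A)) (eA : A -> C) (SA : A -> A)
  (starB : B -> B) (DB : B -> 'T[C]_(B, B)) (eB : B -> C) (SB : B -> B)
  (p : A -> B -> C) : Prop :=
  [/\ (forall b, is_linear ((fun a => p a b) : A -> C^o)) /\
      (forall a, is_linear ((fun b => p a b) : B -> C^o)),
      (forall a, (forall b, p a b = 0) -> a = 0) /\
      (forall b, (forall a, p a b = 0) -> b = 0),
      (forall a b c, p a (b * c) = tpair p (DA a) (tens b c)) /\
      (forall a a' b, p (a * a') b = tpair p (tens a a') (DB b)),
      (forall a, p a 1 = eA a) /\ (forall b, p 1 b = eB b) &
      (forall a b, p (SA a) b = p a (SB b)) /\
      (forall a b, p (starA a) b = (p a (starB (SB b)))^*)].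

(* Main.v *)
(** Proof idea.  The element [h = 1_(2) S(1_(1))] implements [S^2] on [A_t]
    ([x h = h S^2(x)]), so [S^2 k = k], and the slide rules
    [(S(x) # 1) Delta(a) = (1 # x) Delta(a)] for [x] in [A_t] and
    [Delta(a) (y # 1) = Delta(a) (1 # S(y))] for [y] in [A_s] move [k] and [S k]
    freely between the two legs of [Delta].  The one nontrivial identity is
    [S(1_(1)) h^-1 1_(2) = 1]: it yields
    [Delta(1) (1 # h^-1) Delta(1) = Delta(1)], hence multiplicativity of the
    deformed coproduct, and lets [h^-1] be inserted in or removed from
    [S(a_(1)) a_(2)], hence the antipode axioms.  All axioms except the
    C*-algebra one are self-dual under a nondegenerate pairing, so the dual of
    the deformed structure is obtained by transporting it along [[a, b]];
    compatibility with the involutions uses that [x |-> S(x)^*] is an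
    involution, which the given duality forces on both sides. *)
Require Import Defs.
From HB Require Import structures.
From mathcomp Require Import all_boot all_order all_algebra all_field.
From mathcomp Require Import reals complex.
Import GRing.Theory Num.Theory.
Local Open Scope ring_scope.
Set Implicit Arguments.
Unset Strict Implicit.

(** Multiplicativity dictates the deformation: two consecutive copies of [def_Delta] leave
    [k^-1 k^-1 = h^-1] in the second leg between [Delta(a)] and [Delta(b)], and the copies of
    [Delta(1)] hidden in both absorb it. Splitting [h^-1] into a self-adjoint square root on each
    side keeps the coproduct compatible with the involution. The conjugations in [def_S] compensate
    [S^2], which on [A_t] is [x |-> h^-1 x h]. The contraction [S(1_(1)) h^-1 1_(2) = 1] cannot be
    read off from the invertibility of [h = 1_(2) S(1_(1))], since the legs stand in the opposite
    order; hence the computation with two copies of [Delta(1)]. For [B] no formula is guessed: the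
    new coproduct and antipode come from representing forms through the Gram matrix of the deformed
    pairing. Tensors are coefficient matrices, so [\sw_(x, y <- X) E], Sweedler's [E(X_(1), X_(2))],
    evaluates [E] at basis vectors only. Bilinearity of [E] is the price of substituting into a leg,
    whence the many calls of [lin]. *)

Notation "\sw_ ( x , y <- X ) E" := (tcontract (fun x y => E) X)
  (at level 41, E at level 41, x name, y name, X at level 50,
   format "'[' \sw_ ( x ,  y  <-  X ) '/  '  E ']'") : ring_scope.

(** * Tensor calculus in coordinates *)

Section Linear.
Variable C : numClosedFieldType.
Implicit Types U V W Z : vectType C.

Definition bilinear_map U V W (phi : U -> V -> W) : Prop :=
  (forall v, is_linear (phi^~ v)) /\ (forall u, is_linear (phi u)).

Lemma lin_id U : is_linear (fun x : U => x).
Proof. by []. Qed.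

Lemma lin_comp U V W (g : V -> W) (f : U -> V) :
  is_linear g -> is_linear f -> is_linear (fun x => g (f x)).
Proof. by move=> gl fl c x y; rewrite fl gl. Qed.

Lemma lin_mull U (A : falgType C) (a : A) (f : U -> A) :
  is_linear f -> is_linear (fun x => a * f x).
Proof. by move=> fl c x y; rewrite fl mulrDr scalerAr. Qed.

Lemma lin_mulr U (A : falgType C) (a : A) (f : U -> A) :
  is_linear f -> is_linear (fun x => f x * a).
Proof. by move=> fl c x y; rewrite fl mulrDl scalerAl. Qed.

Lemma lin_scalel U W (w : W) (f : U -> C) :
  is_linear (V := C^o) f -> is_linear (fun x => f x *: w).
Proof. by move=> fl c x y; rewrite fl scalerDl scalerA. Qed.

Lemma lin_scaler U W (a : C) (f : U -> W) :
  is_linear f -> is_linear (fun x => a *: f x).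
Proof. by move=> fl c x y; rewrite fl scalerDr !scalerA mulrC. Qed.

Lemma lin_cmull U (a : C) (f : U -> C) :
  is_linear (V := C^o) f -> is_linear (V := C^o) (fun x => a * f x).
Proof. by move=> fl c x y; rewrite fl mulrDr /GRing.scale /= mulrCA. Qed.

Lemma lin_cmulr U (a : C) (f : U -> C) :
  is_linear (V := C^o) f -> is_linear (V := C^o) (fun x => f x * a).
Proof. by move=> fl c x y; rewrite fl mulrDl /GRing.scale /= mulrA. Qed.

Lemma bilinl U V W Z (phi : U -> V -> W) (f : Z -> U) v :
  bilinear_map phi -> is_linear f -> is_linear (fun x => phi (f x) v).
Proof. by case=> pl _; apply: (@lin_comp _ _ _ (phi^~ v)). Qed.

Lemma bilinr U V W Z (phi : U -> V -> W) (f : Z -> V) u :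
  bilinear_map phi -> is_linear f -> is_linear (fun x => phi u (f x)).
Proof. by case=> _ pl; apply: lin_comp. Qed.

Lemma lin0 U V (f : U -> V) : is_linear f -> f 0 = 0.
Proof.
move=> fl; have := fl 1 0 0; rewrite !scale1r addr0 => /esym/eqP.
by rewrite -subr_eq0 addrK => /eqP.
Qed.

Lemma linD U V (f : U -> V) : is_linear f -> {morph f : x y / x + y}.
Proof. by move=> fl x y; have := fl 1 x y; rewrite !scale1r. Qed.

Lemma linZ U V (f : U -> V) c x : is_linear f -> f (c *: x) = c *: f x.
Proof. by move=> fl; have := fl c x 0; rewrite !addr0 (lin0 fl) addr0. Qed.

Lemma lin_sum U V (f : U -> V) I (r : seq I) (P : pred I) F : is_linear f ->
  f (\sum_(i <- r | P i) F i) = \sum_(i <- r | P i) f (F i).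
Proof. by move=> fl; apply: big_morph; [exact: linD | exact: lin0]. Qed.

Lemma is_linear_sum U V I (r : seq I) (P : pred I) (F : I -> U -> V) :
  (forall i, is_linear (F i)) -> is_linear (fun x => \sum_(i <- r | P i) F i x).
Proof.
move=> Fl c x y; rewrite scaler_sumr -big_split /=.
by apply: eq_bigr => i _; rewrite Fl.
Qed.

Lemma vec_be U (u : U) : u = \sum_i crd i u *: be i.
Proof.
rewrite {1}(coord_vbasis (memvf u)); apply: eq_bigr => i _.
by rewrite /crd /be (tnth_nth 0).
Qed.

Lemma crd_lin U (i : 'I_(bdim U)) : is_linear (crd i : U -> C^o).
Proof. by move=> c x y; rewrite /crd linearP. Qed.

Lemma crd_be U (i j : 'I_(bdim U)) : crd i (be j : U) = (i == j)%:R.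
Proof.
by rewrite /crd /be (tnth_nth 0) coord_free ?(basis_free (vbasisP _)) // eq_sym.
Qed.

Lemma tens_bilin U V : bilinear_map (@tens C U V).
Proof.
split=> [v | u] c x y; apply/matrixP=> i j; rewrite !mxE crd_lin.
  by rewrite mulrDl mulrA.
by rewrite mulrDr /GRing.scale /= mulrCA.
Qed.

Lemma tens_be U V (i : 'I_(bdim U)) (j : 'I_(bdim V)) :
  tens (be i) (be j) = delta_mx i j.
Proof. by apply/matrixP=> a b; rewrite !mxE !crd_be -natrM mulnb. Qed.

(** The bridge from tensors to contractions: an equation between tensors is proved by expanding both
    sides this way and comparing the contracted expressions. *)
Lemma tens_expand U V (X : 'T[C]_(U, V)) : X = \sw_(x, y <- X) tens x y.
Proof.
rewrite {1}[X]matrix_sum_delta; apply: eq_bigr => i _; apply: eq_bigr => j _.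
by rewrite tens_be.
Qed.

Lemma sw_lin U V W (phi : U -> V -> W) : is_linear (tcontract phi).
Proof.
move=> c X Y; rewrite /tcontract scaler_sumr -big_split; apply: eq_bigr => i _.
rewrite scaler_sumr -big_split; apply: eq_bigr => j _.
by rewrite !mxE scalerDl scalerA.
Qed.

Lemma lin_swX U V W Z (phi : V -> W -> Z) (f : U -> 'T[C]_(V, W)) :
  is_linear f -> is_linear (fun x => tcontract phi (f x)).
Proof. by move=> fl; apply: lin_comp fl; apply: sw_lin. Qed.

Lemma lin_sw U V W Z (F : U -> V -> W -> Z) (X : 'T[C]_(V, W)) :
  (forall v w, is_linear (fun x => F x v w)) ->
  is_linear (fun x => tcontract (F x) X).
Proof.
move=> Fl; apply: is_linear_sum => i; apply: is_linear_sum => j.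
exact: lin_scaler.
Qed.

Lemma lin_tmap U V U' V' (f : U -> U') (g : V -> V') : is_linear (tmap f g).
Proof. exact: sw_lin. Qed.

Lemma sw_ext U V W (phi psi : U -> V -> W) X :
  (forall x y, phi x y = psi x y) -> tcontract phi X = tcontract psi X.
Proof. by move=> E; do 2![apply: eq_bigr => ? _]; rewrite E. Qed.

Lemma lin_swE U V W Z (f : W -> Z) (phi : U -> V -> W) X :
  is_linear f -> f (tcontract phi X) = \sw_(x, y <- X) f (phi x y).
Proof.
move=> fl; rewrite /tcontract lin_sum //; apply: eq_bigr => i _.
by rewrite lin_sum //; apply: eq_bigr => j _; rewrite linZ.
Qed.

Lemma sw_tens U V W (phi : U -> V -> W) u v :
  bilinear_map phi -> tcontract phi (tens u v) = phi u v.
Proof.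
case=> pl pr; rewrite {2}(vec_be u) {2}(vec_be v) (lin_sum _ _ _ (pl _)).
apply: eq_bigr => i _; rewrite (lin_sum _ _ _ (pr _)); apply: eq_bigr => j _.
by rewrite mxE (linZ _ _ (pl _)) (linZ _ _ (pr _)) scalerA.
Qed.

End Linear.

Definition trilinear_map (C : numClosedFieldType) (U V W Z : vectType C)
    (T : U -> V -> W -> Z) : Prop :=
  [/\ forall v w, is_linear (fun u => T u v w),
      forall u w, is_linear (fun v => T u v w) &
      forall u v, is_linear (fun w => T u v w)].

Lemma trilin1 (C : numClosedFieldType) (U V W Z Y : vectType C)
    (T : U -> V -> W -> Z) (f : Y -> U) v w :
  trilinear_map T -> is_linear f -> is_linear (fun x => T (f x) v w).
Proof. by case=> Tl _ _; apply: (lin_comp (Tl v w)). Qed.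

Lemma trilin2 (C : numClosedFieldType) (U V W Z Y : vectType C)
    (T : U -> V -> W -> Z) (f : Y -> V) u w :
  trilinear_map T -> is_linear f -> is_linear (fun x => T u (f x) w).
Proof. by case=> _ Tl _; apply: (lin_comp (Tl u w)). Qed.

Lemma trilin3 (C : numClosedFieldType) (U V W Z Y : vectType C)
    (T : U -> V -> W -> Z) (f : Y -> W) u v :
  trilinear_map T -> is_linear f -> is_linear (fun x => T u v (f x)).
Proof. by case=> _ _ Tl; apply: (lin_comp (Tl u v)). Qed.

Lemma tmulE (C : numClosedFieldType) (U V : vectType C) (mU : U -> U -> U) (mV : V -> V -> V) X X' :
  tmul mU mV X X' = \sw_(x, y <- X) \sw_(u, v <- X') tens (mU x u) (mV y v).
Proof.
apply: eq_bigr => i _; apply: eq_bigr => j _.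
rewrite scaler_sumr; apply: eq_bigr => k _.
by rewrite scaler_sumr; apply: eq_bigr => l _; rewrite scalerA.
Qed.

Lemma mulT_bilin (C : numClosedFieldType) (A : falgType C) :
  bilinear_map (@mulT C A).
Proof.
split=> X c Y Z; rewrite /mulT !tmulE; first exact: sw_lin.
apply: (lin_sw (F := fun Y x y => \sw_(u, v <- Y) tens (x * u) (y * v))) => x y.
exact: sw_lin.
Qed.

(** The search follows the shape of the term. For an unknown function it uses a linearity hypothesis
    of the context, which is why the sections restate the linearity of their structure maps by
    [Let]. *)
Ltac lin :=
  cbv beta;
  lazymatch goal with
  | |- forall _, _ => intro; lin
  | |- _ /\ _ => split; lin
  | |- bilinear_map _ => first [assumption | exact: tens_bilin | exact: mulT_bilin | split; lin]
  | |- trilinear_map _ => first [assumption | split; lin]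
  | |- is_linear _ =>
    first
    [ assumption | exact: lin_id | exact: sw_lin
    | lazymatch goal with
      | |- is_linear (fun _ => _) => fail
      | |- @is_linear ?C ?U ?V ?f => change (@is_linear C U V (fun x => f x)); lin
      end
    | match goal with
      | |- is_linear (fun x => @GRing.mul _ (@?f x) ?c) =>
          first [refine (lin_cmulr _ _); lin | refine (lin_mulr _ _); lin]
      | |- is_linear (fun x => @GRing.mul _ ?c (@?f x)) =>
          first [refine (lin_cmull _ _); lin | refine (lin_mull _ _); lin]
      | |- is_linear (fun x => @GRing.scale _ _ (@?f x) ?c) =>
          refine (lin_scalel _ _); lin
      | |- is_linear (fun x => @GRing.scale _ _ ?c (@?f x)) =>
          refine (lin_scaler _ _); lin
      | |- is_linear (fun x => tcontract ?phi (@?f x)) =>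
          refine (lin_swX _ _); lin
      | |- is_linear (fun x => tmap ?phi ?psi (@?f x)) =>
          refine (lin_comp (lin_tmap _ _) _); lin
      | |- is_linear (fun x => tcontract (@?F x) ?c) =>
          refine (lin_sw _ _); lin
      | |- is_linear (fun x => tens (@?f x) ?c) =>
          refine (bilinl _ (tens_bilin _ _) _); lin
      | |- is_linear (fun x => tens ?c (@?f x)) =>
          refine (bilinr _ (tens_bilin _ _) _); lin
      | |- is_linear (fun x => mulT (@?f x) ?c) =>
          refine (bilinl _ (mulT_bilin _) _); lin
      | |- is_linear (fun x => mulT ?c (@?f x)) =>
          refine (bilinr _ (mulT_bilin _) _); lin
      | |- is_linear (fun x => ?g (@?f x) ?c ?d) =>
          match goal with H : trilinear_map g |- _ => 
          refine (trilin1 _ _ H _) end; lin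
      | |- is_linear (fun x => ?g ?c (@?f x) ?d) =>
          match goal with H : trilinear_map g |- _ => 
          refine (trilin2 _ _ H _) end; lin
      | |- is_linear (fun x => ?g ?c ?d (@?f x)) =>
          match goal with H : trilinear_map g |- _ => 
          refine (trilin3 _ _ H _) end; lin
      end
    | match goal with
      | |- is_linear (fun x => ?g (@?f x) ?c) =>
          match goal with H : bilinear_map g |- _ => 
          refine (bilinl _ H _) end; lin
      | |- is_linear (fun x => ?g ?c (@?f x)) =>
          match goal with H : bilinear_map g |- _ => 
          refine (bilinr _ H _) end; lin
      end
    | match goal with
      | |- is_linear (fun x => ?g (@?f x)) =>
          match goal with H : is_linear g |- _ => 
          refine (lin_comp H _) end; lin
      end ]
  end.

(** * Nested contractions, triple tensors, and the product and involution on [A # A] *)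

Section Tensor.
Variable C : numClosedFieldType.
Implicit Types U V W Z : vectType C.

Lemma sw_sw U V W Z (Y : vectType C) (phi : W -> Z -> Y) (psi : U -> V -> 'T[C]_(W, Z)) X :
  tcontract phi (tcontract psi X) = \sw_(x, y <- X) tcontract phi (psi x y).
Proof. exact: (lin_swE _ _ (sw_lin phi)). Qed.

Lemma tcontract_pair U V W (phi : U -> V -> W) X :
  tcontract phi X = \sum_p X p.1 p.2 *: phi (be p.1) (be p.2).
Proof. by rewrite /tcontract pair_bigA. Qed.

(** Finite sums exchange and scalar coefficients commute; [X'] must not depend on the legs of
    [X]. *)
Lemma sw_swap U V W Z (Y : vectType C) (T : U -> V -> W -> Z -> Y) X X' :
  \sw_(x, y <- X) \sw_(u, v <- X') T x y u v =
  \sw_(u, v <- X') \sw_(x, y <- X) T x y u v.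
Proof.
rewrite !tcontract_pair; under eq_bigr do rewrite tcontract_pair scaler_sumr.
rewrite exchange_big; apply: eq_bigr => p _ /=.
rewrite tcontract_pair scaler_sumr; apply: eq_bigr => r _.
by rewrite !scalerA mulrC.
Qed.

Lemma sw_tmap U V U' V' W (f : U -> U') (g : V -> V') (phi : U' -> V' -> W) X :
  bilinear_map phi ->
  tcontract phi (tmap f g X) = \sw_(x, y <- X) phi (f x) (g y).
Proof. by move=> pl; rewrite sw_sw; apply: sw_ext => x y; rewrite sw_tens. Qed.

Lemma sw_tflip U V W (phi : V -> U -> W) (X : 'T[C]_(U, V)) :
  bilinear_map phi -> tcontract phi (tflip X) = \sw_(x, y <- X) phi y x.
Proof. by move=> pl; rewrite sw_sw; apply: sw_ext => x y; rewrite sw_tens. Qed.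

Lemma sw_mulT (A : falgType C) W (phi : A -> A -> W) X X' : bilinear_map phi ->
  tcontract phi (mulT X X') = \sw_(x, y <- X) \sw_(u, v <- X') phi (x * u) (y * v).
Proof.
move=> pl; rewrite /mulT tmulE sw_sw; apply: sw_ext => x y.
by rewrite sw_sw; apply: sw_ext => u v; rewrite sw_tens.
Qed.

(** Together with [tassoc_tmapE] this brings both bracketings of a triple tensor to the form
    [(x # y) # z], on which [contr3] acts. *)
Lemma tmap_idrE U V W Z (f : U -> 'T[C]_(W, Z)) (X : 'T[C]_(U, V)) :
  tmap f id X = \sw_(u, v <- X) \sw_(x, y <- f u) tens (tens x y) v.
Proof.
apply: sw_ext => u v; rewrite {1}[f u]tens_expand.
apply: (lin_swE (f := fun t => tens t v)). lin.
Qed.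

Lemma sw_tassoc_tens U V W (u : U) (X : 'T[C]_(V, W)) :
  tassoc (tens u X) = \sw_(v, w <- X) tens (tens u v) w.
Proof. by rewrite /tassoc sw_tens //; lin. Qed.

Lemma tassoc_tmapE U V W Z (f : V -> 'T[C]_(W, Z)) (X : 'T[C]_(U, V)) :
  tassoc (tmap id f X) = \sw_(u, v <- X) \sw_(x, y <- f v) tens (tens u x) y.
Proof.
rewrite /tassoc sw_sw; apply: sw_ext => u v; exact: sw_tassoc_tens.
Qed.

Definition contr3 U V W Z (T : U -> V -> W -> Z) : 'T[C]_('T[C]_(U, V), W) -> Z :=
  tcontract (fun M z => \sw_(x, y <- M) T x y z).

Lemma contr3_lin U V W Z (T : U -> V -> W -> Z) : is_linear (contr3 T).
Proof. exact: sw_lin. Qed.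

Lemma contr3_tens U V W Z (T : U -> V -> W -> Z) x y z :
  trilinear_map T -> contr3 T (tens (tens x y) z) = T x y z.
Proof. by move=> Tl; rewrite /contr3 sw_tens ?sw_tens //; lin. Qed.

Lemma contr3_sw2 U V W Z (X1 Y1 X2 Y2 : vectType C) (T : U -> V -> W -> Z)
    (F : X1 -> Y1 -> X2 -> Y2 -> U) (G : X1 -> Y1 -> X2 -> Y2 -> V)
    (H : X1 -> Y1 -> X2 -> Y2 -> W) X (X' : X1 -> Y1 -> 'T[C]_(X2, Y2)) :
  trilinear_map T ->
  contr3 T (\sw_(x, y <- X) \sw_(u, v <- X' x y)
     tens (tens (F x y u v) (G x y u v)) (H x y u v)) =
  \sw_(x, y <- X) \sw_(u, v <- X' x y) T (F x y u v) (G x y u v) (H x y u v).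
Proof.
move=> Tl; rewrite (lin_swE _ _ (contr3_lin T)); apply: sw_ext => x y.
rewrite (lin_swE _ _ (contr3_lin T)); apply: sw_ext => u v.
exact: contr3_tens.
Qed.

Variable A : falgType C.

Lemma mulTA : associative (@mulT C A).
Proof.
move=> X X1 X2; rewrite [LHS]tens_expand [RHS]tens_expand !sw_mulT; try lin.
apply: sw_ext => x y; rewrite sw_mulT; last lin.
by do 2![apply: sw_ext => ? ?]; rewrite !mulrA.
Qed.

Lemma mulT1 X : mulT X (tens (1 : A) 1) = X.
Proof.
rewrite [LHS]tens_expand [RHS]tens_expand !sw_mulT; try lin.
by apply: sw_ext => x y; rewrite sw_tens ?mulr1 //; lin.
Qed.

Lemma mul1T X : mulT (tens (1 : A) 1) X = X.
Proof.
rewrite [LHS]tens_expand [RHS]tens_expand !sw_mulT; try lin.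
by rewrite sw_tens; [apply: sw_ext => x y; rewrite !mul1r | lin].
Qed.

Lemma mulT_tens (a b c d : A) : mulT (tens a b) (tens c d) = tens (a * c) (b * d).
Proof.
rewrite [LHS]tens_expand sw_mulT; last lin.
by rewrite !sw_tens //; lin.
Qed.

Lemma sw_tensl W (phi : A -> A -> W) a b X : bilinear_map phi ->
  tcontract phi (mulT (tens a b) X) = \sw_(x, y <- X) phi (a * x) (b * y).
Proof. by move=> pl; rewrite sw_mulT // sw_tens //; lin. Qed.

Lemma sw_tensr W (phi : A -> A -> W) a b X : bilinear_map phi ->
  tcontract phi (mulT X (tens a b)) = \sw_(x, y <- X) phi (x * a) (y * b).
Proof.
by move=> pl; rewrite sw_mulT //; apply: sw_ext => x y; rewrite sw_tens //; lin.
Qed.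

Lemma mulT3_tens (M N : 'T[C]_(A, A)) (z w : A) :
  mulT3 (tens M z) (tens N w) = tens (mulT M N) (z * w).
Proof.
rewrite /mulT3 tmulE sw_tens; last lin.
by rewrite sw_tens //; lin.
Qed.

Lemma mulT3_bilin : bilinear_map (@mulT3 C A).
Proof.
split=> X c Y Z; rewrite /mulT3 !tmulE; first exact: sw_lin.
pose F (Y : 'T[C]_('T[C]_(A, A), A)) x y := \sw_(u, v <- Y) tens (mulT x u) (y * v).
apply: (lin_sw (F := F)) => x y.
exact: sw_lin.
Qed.

Lemma mulT3_lE (X X' : 'T[C]_(A, A)) :
  mulT3 (tassoc (tens 1 X)) (tens X' 1) =
  \sw_(x, y <- X) \sw_(u, v <- X') tens (tens u (x * v)) y.
Proof.
rewrite sw_tassoc_tens (lin_swE _ _ (mulT3_bilin.1 _)); apply: sw_ext => x y.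
rewrite mulT3_tens mulr1 [X in tens X _]tens_expand.
rewrite (lin_swE (f := fun t => tens t y)); last lin.
rewrite (sw_tensl (phi := fun a b => tens (tens a b) y)); last lin.
by apply: sw_ext => u v; rewrite mul1r.
Qed.

Lemma mulT3_rE (X X' : 'T[C]_(A, A)) :
  mulT3 (tens X' 1) (tassoc (tens 1 X)) =
  \sw_(x, y <- X) \sw_(u, v <- X') tens (tens u (v * x)) y.
Proof.
rewrite sw_tassoc_tens (lin_swE _ _ (mulT3_bilin.2 _)); apply: sw_ext => x y.
rewrite mulT3_tens mul1r [X in tens X _]tens_expand.
rewrite (lin_swE (f := fun t => tens t y)); last lin.
rewrite (sw_tensr (phi := fun a b => tens (tens a b) y)); last lin.
by apply: sw_ext => u v; rewrite mulr1.
Qed.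

Lemma eps_tE D (e : A -> C) g : is_linear (e : A -> C^o) ->
  eps_t D e g = \sw_(x, y <- D 1) e (x * g) *: y.
Proof.
move=> el; rewrite /eps_t sw_tensr; last lin.
by apply: sw_ext => x y; rewrite mulr1.
Qed.

Lemma eps_sE D (e : A -> C) g : is_linear (e : A -> C^o) ->
  eps_s D e g = \sw_(x, y <- D 1) e (g * y) *: x.
Proof.
move=> el; rewrite /eps_s sw_tensl; last lin.
by apply: sw_ext => x y; rewrite mul1r.
Qed.

Variable star : A -> A.
Hypothesis starl : forall (c : C) (x y : A), star (c *: x + y) = c^* *: star x + star y.
Hypothesis starM : forall x y : A, star (x * y) = star y * star x.

Lemma antilin_sum U V (f : U -> V) I (r : seq I) (c : I -> C) (F : I -> U) :
  (forall (c : C) x y, f (c *: x + y) = c^* *: f x + f y) ->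
  f (\sum_(i <- r) c i *: F i) = \sum_(i <- r) (c i)^* *: f (F i).
Proof.
move=> fl; have f0 : f 0 = 0.
  have := fl 1 0 0; rewrite rmorph1 !scale1r addr0 => /esym/eqP.
  by rewrite -subr_eq0 addrK => /eqP.
elim: r => [|i r IH]; first by rewrite !big_nil.
by rewrite !big_cons fl IH.
Qed.

Lemma tstarE X :
  tstar star star X = \sum_p (X p.1 p.2)^* *: tens (star (be p.1)) (star (be p.2)).
Proof. by rewrite /tstar pair_bigA. Qed.

Lemma tstar_antilin (c : C) X Y :
  tstar star star (c *: X + Y) = c^* *: tstar star star X + tstar star star Y.
Proof.
rewrite !tstarE scaler_sumr -big_split; apply: eq_bigr => p _ /=.
by rewrite !mxE rmorphD rmorphM scalerDl scalerA.
Qed.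

Lemma tstar_tens (x y : A) : tstar star star (tens x y) = tens (star x) (star y).
Proof.
rewrite {2}(vec_be x) {2}(vec_be y) !(antilin_sum _ _ _ starl).
rewrite /tstar (lin_sum _ _ _ ((tens_bilin A A).1 _)); apply: eq_bigr => i _.
rewrite (lin_sum _ _ _ ((tens_bilin A A).2 _)); apply: eq_bigr => j _.
rewrite mxE rmorphM (linZ _ _ ((tens_bilin A A).1 _)).
by rewrite (linZ _ _ ((tens_bilin A A).2 _)) scalerA.
Qed.

Lemma tstar_mulT X Y :
  tstar star star (mulT X Y) = mulT (tstar star star Y) (tstar star star X).
Proof.
(* [tstar] is antilinear and does not pass through [tcontract], so the sums over index pairs are
   written out and the conjugated coefficients matched. *)
rewrite {1}[X]tens_expand {1}[Y]tens_expand !tcontract_pair.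
rewrite (lin_sum _ _ _ ((mulT_bilin A).1 _)).
under eq_bigr do rewrite (linZ _ _ ((mulT_bilin A).1 _)).
rewrite (antilin_sum _ _ _ tstar_antilin) (tstarE X) (lin_sum _ _ _ ((mulT_bilin A).2 _)).
apply: eq_bigr => p _; rewrite (linZ _ _ ((mulT_bilin A).2 _)); congr (_ *: _).
rewrite (lin_sum _ _ _ ((mulT_bilin A).2 _)).
under eq_bigr do rewrite (linZ _ _ ((mulT_bilin A).2 _)).
rewrite (antilin_sum _ _ _ tstar_antilin) (tstarE Y) (lin_sum _ _ _ ((mulT_bilin A).1 _)).
apply: eq_bigr => r _; rewrite (linZ _ _ ((mulT_bilin A).1 _)); congr (_ *: _).
by rewrite !mulT_tens tstar_tens !starM.
Qed.

End Tensor.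

(** * Sweedler calculus in a weak Hopf algebra *)

Section WeakHopf.
Variables (C : numClosedFieldType) (A : falgType C).
Variables (star : A -> A) (D : A -> 'T[C]_(A, A)) (e : A -> C) (S : A -> A).
Hypothesis H : is_CQG star D e S.
Implicit Types (W : vectType C) (a b x y : A).

Lemma Delta_lin : is_linear D. Proof. by case: H => _ []. Qed.
Lemma eps_lin : is_linear (e : A -> C^o). Proof. by case: H => _ _ []. Qed.
Lemma S_lin : is_linear S. Proof. by case: H => _ _ _ _ []. Qed.

Let Dl := Delta_lin.
Let el := eps_lin.
Let Sl := S_lin.

Lemma DeltaM a b : D (a * b) = mulT (D a) (D b).
Proof. by case: H => _ [] _ _ ->. Qed.

(** Applying [contr3 T] to the equation between triple tensors turns it into a rewrite rule between
    nested contractions. *)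
Lemma coassoc W (T : A -> A -> A -> W) a : trilinear_map T ->
  \sw_(x, z <- D a) \sw_(u, v <- D x) T u v z =
  \sw_(x, z <- D a) \sw_(u, v <- D z) T x u v.
Proof.
move=> Tl; case: H => _ [_ /(_ a) E _ _] _ _ _.
move/(congr1 (contr3 T)): E.
by rewrite tmap_idrE tassoc_tmapE !contr3_sw2.
Qed.

Lemma counitl W (f : A -> W) a : is_linear f -> \sw_(x, y <- D a) e x *: f y = f a.
Proof.
move=> fl; case: H => _ _ [_ /(_ a) E _ _ _] _ _; rewrite -[in RHS]E.
by rewrite lin_swE //; apply: sw_ext => x y; rewrite linZ.
Qed.

Lemma counitr W (f : A -> W) a : is_linear f -> \sw_(x, y <- D a) e y *: f x = f a.
Proof.
move=> fl; case: H => _ _ [_ _ /(_ a) E _ _] _ _; rewrite -[in RHS]E.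
by rewrite lin_swE //; apply: sw_ext => x y; rewrite linZ.
Qed.

Lemma epsM12 a b c :
  e (a * b * c) = \sw_(x, y <- D b) (e (a * x) * e (y * c) : C^o).
Proof. by case: H => _ _ [_ _ _ E _] _ _; apply: E. Qed.

Lemma epsM21 a b c :
  e (a * b * c) = \sw_(x, y <- D b) (e (a * y) * e (x * c) : C^o).
Proof. by case: H => _ _ [_ _ _ _ E] _ _; apply: E. Qed.

Lemma weak_unit_lr W (T : A -> A -> A -> W) : trilinear_map T ->
  \sw_(x, z <- D 1) \sw_(u, v <- D x) T u v z =
  \sw_(x, z <- D 1) \sw_(u, v <- D 1) T u (x * v) z.
Proof.
move=> Tl; case: H => _ _ _ [/(congr1 (contr3 T)) E _] _; move: E.
by rewrite tmap_idrE mulT3_lE !contr3_sw2.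
Qed.

Lemma weak_unit_rl W (T : A -> A -> A -> W) : trilinear_map T ->
  \sw_(x, z <- D 1) \sw_(u, v <- D x) T u v z =
  \sw_(x, z <- D 1) \sw_(u, v <- D 1) T u (v * x) z.
Proof.
move=> Tl; case: H => _ _ _ [_ /(congr1 (contr3 T)) E] _; move: E.
by rewrite tmap_idrE mulT3_rE !contr3_sw2.
Qed.

Lemma S1 : S 1 = 1. Proof. by case: H => _ _ _ _ [_ []]. Qed.
Lemma SM a b : S (a * b) = S b * S a.
Proof. by case: H => _ _ _ _ [_ [_ E]]. Qed.
Lemma epsS a : e (S a) = e a.
Proof. by case: H => _ _ _ _ [_ _ [_ E]]. Qed.

Lemma DeltaS W (phi : A -> A -> W) a : bilinear_map phi ->
  tcontract phi (D (S a)) = \sw_(x, y <- D a) phi (S y) (S x).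
Proof.
move=> pl; case: H => _ _ _ _ [_ _ [-> _] _ _].
by rewrite sw_tflip // sw_tmap //; lin.
Qed.

Lemma eps_t_lin : is_linear (eps_t D e).
Proof. rewrite /eps_t; lin. Qed.
Lemma eps_s_lin : is_linear (eps_s D e).
Proof. rewrite /eps_s; lin. Qed.
Let etl := eps_t_lin.
Let esl := eps_s_lin.

Lemma eps_t1 : eps_t D e 1 = 1.
Proof.
rewrite eps_tE // -[RHS](counitl (f := fun x => x)); last lin.
by apply: sw_ext => x y; rewrite mulr1.
Qed.

Lemma eps_s1 : eps_s D e 1 = 1.
Proof.
rewrite eps_sE // -[RHS](counitr (f := fun x => x)); last lin.
by apply: sw_ext => x y; rewrite mul1r.
Qed.

Lemma mulS_eps_t a : \sw_(x, y <- D a) (x * S y) = eps_t D e a.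
Proof. by case: H => _ _ _ _ [_ _ _ [E _]]. Qed.
Lemma Smul_eps_s a : \sw_(x, y <- D a) (S x * y) = eps_s D e a.
Proof. by case: H => _ _ _ _ [_ _ _ [_ E]]. Qed.

Lemma SmulmulS a : \sw_(x, z <- D a) \sw_(u, v <- D x) (S u * v * S z) = S a.
Proof.
case: H => _ _ _ _ [_ _ _ _ /(_ a) E]; rewrite -[RHS]E sw_sw.
by apply: sw_ext => x z; rewrite sw_tens //; lin.
Qed.

Lemma DeltaE1l a : mulT (D 1) (D a) = D a.
Proof. by rewrite -DeltaM mul1r. Qed.
Lemma DeltaE1r a : mulT (D a) (D 1) = D a.
Proof. by rewrite -DeltaM mulr1. Qed.

(* Stand-ins for membership in A_t and A_s (see target_like_eps_t and
   source_like_eps_s) for which stability under products and inverses is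
   immediate. *)
Definition target_like x := forall a,
  D (x * a) = mulT (tens x 1) (D a) /\ D (a * x) = mulT (D a) (tens x 1).
Definition source_like y := forall a,
  D (y * a) = mulT (tens 1 y) (D a) /\ D (a * y) = mulT (D a) (tens 1 y).

(** By coassociativity [Delta(eps_t(a)) = e(1_(1) a) 1_(2) # 1_(3)]. Splitting
    [1_(1) # 1_(2) # 1_(3)] into two copies of [Delta(1)], in one order or the other, puts
    [eps_t(a)] to the left or to the right of the first leg. *)
Lemma target_like_eps_t a : target_like (eps_t D e a).
Proof.
(* The value at 1 suffices, because [Delta(b)] absorbs [Delta(1)] on either side. *)
suff E : D (eps_t D e a) = mulT (tens (eps_t D e a) 1) (D 1) /\
         D (eps_t D e a) = mulT (D 1) (tens (eps_t D e a) 1).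
  move=> b; rewrite !DeltaM {1}E.1 E.2; split.
    by rewrite -mulTA DeltaE1l.
  by rewrite mulTA DeltaE1r.
have E : D (eps_t D e a) =
    \sw_(x, z <- D 1) \sw_(u, v <- D x) (e (u * a) *: tens v z).
  rewrite eps_tE // (lin_swE _ _ Dl).
  rewrite (coassoc (T := fun u v z => e (u * a) *: tens v z)); last lin.
  apply: sw_ext => x y; rewrite linZ // [D y]tens_expand.
  by rewrite [LHS](lin_swE (f := fun t => e (x * a) *: t)) -?tens_expand //; lin.
split; rewrite E.
  rewrite (weak_unit_rl (T := fun u v z => e (u * a) *: tens v z)); last lin.
  rewrite [RHS]tens_expand sw_tensl; last lin.
  apply: sw_ext => x y; rewrite eps_tE // mul1r.
  rewrite (lin_swE (f := fun t => tens (t * x) y)); last lin.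
  by apply: sw_ext => u v; rewrite (linZ (f := fun t => tens (t * x) y)) //; lin.
rewrite (weak_unit_lr (T := fun u v z => e (u * a) *: tens v z)); last lin.
rewrite [RHS]tens_expand sw_tensr; last lin.
apply: sw_ext => x y; rewrite eps_tE // mulr1.
rewrite (lin_swE (f := fun t => tens (x * t) y)); last lin.
by apply: sw_ext => u v; rewrite (linZ (f := fun t => tens (x * t) y)) //; lin.
Qed.

Lemma source_like_eps_s a : source_like (eps_s D e a).
Proof.
suff E : D (eps_s D e a) = mulT (tens 1 (eps_s D e a)) (D 1) /\
         D (eps_s D e a) = mulT (D 1) (tens 1 (eps_s D e a)).
  move=> b; rewrite !DeltaM {1}E.1 E.2; split.
    by rewrite -mulTA DeltaE1l.
  by rewrite mulTA DeltaE1r.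
have E : D (eps_s D e a) =
    \sw_(x, z <- D 1) \sw_(u, v <- D x) (e (a * z) *: tens u v).
  rewrite eps_sE // (lin_swE _ _ Dl); apply: sw_ext => x y.
  rewrite linZ // {1}[D x]tens_expand.
  by rewrite [LHS](lin_swE (f := fun t => e (a * y) *: t)) //; lin.
split; rewrite E.
  rewrite (weak_unit_lr (T := fun u v z => e (a * z) *: tens u v)); last lin.
  rewrite [RHS]tens_expand sw_tensl; last lin.
  rewrite sw_swap; apply: sw_ext => x y; rewrite eps_sE // mul1r.
  rewrite (lin_swE (f := fun t => tens x (t * y))); last lin.
  by apply: sw_ext => u v; rewrite (linZ (f := fun t => tens x (t * y))) //; lin.
rewrite (weak_unit_rl (T := fun u v z => e (a * z) *: tens u v)); last lin.
rewrite [RHS]tens_expand sw_tensr; last lin.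
rewrite sw_swap; apply: sw_ext => x y; rewrite eps_sE // mulr1.
rewrite (lin_swE (f := fun t => tens x (y * t))); last lin.
by apply: sw_ext => u v; rewrite (linZ (f := fun t => tens x (y * t))) //; lin.
Qed.

(** [S] reverses both products and coproducts, so it turns [a_(1) S(a_(2))] into [S(b_(1)) b_(2)]
    with [b = S(a)]. *)
Lemma S_eps_t a : S (eps_t D e a) = eps_s D e (S a).
Proof.
rewrite -mulS_eps_t -Smul_eps_s DeltaS; last lin.
by rewrite lin_swE //; apply: sw_ext => x y; rewrite SM.
Qed.

Lemma S_eps_s a : S (eps_s D e a) = eps_t D e (S a).
Proof.
rewrite -mulS_eps_t -Smul_eps_s DeltaS; last lin.
by rewrite lin_swE //; apply: sw_ext => x y; rewrite SM.
Qed.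

(** Both products are the same contraction [T] of [1_(1) # 1_(2) # 1_(3)]: the two orders of the
    weak unit axiom multiply the middle legs in the two orders. *)
Lemma eps_ts_comm a b : eps_t D e a * eps_s D e b = eps_s D e b * eps_t D e a.
Proof.
pose T u w z : A := (e (u * a) * e (b * z)) *: w.
have Tl : trilinear_map T by rewrite /T; lin.
transitivity (\sw_(x, z <- D 1) \sw_(u, v <- D 1) T u (v * x) z).
  rewrite {1}eps_tE // (lin_swE (f := fun t => t * eps_s D e b)); last lin.
  rewrite sw_swap; apply: sw_ext => u v.
  rewrite eps_sE // (lin_swE (f := fun t => (e (u * a) *: v) * t)); last lin.
  by apply: sw_ext => x z; rewrite /T -scalerAl -scalerAr scalerA.
rewrite -weak_unit_rl // weak_unit_lr // [X in _ * X]eps_tE //.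
rewrite (lin_swE (f := fun t => eps_s D e b * t)); last lin.
rewrite sw_swap; apply: sw_ext => u v.
rewrite eps_sE // (lin_swE (f := fun t => t * (e (u * a) *: v))); last lin.
by apply: sw_ext => x z; rewrite /T -scalerAl -scalerAr scalerA mulrC.
Qed.

(** The first leg of [Delta(1)] lies in [A_s]: unfolding [eps_s] brings in a second copy of
    [Delta(1)], the weak unit axiom merges the copies, and the counit removes the middle leg. *)
Lemma eps_s_leg1 W (phi : A -> A -> W) : bilinear_map phi ->
  \sw_(x, y <- D 1) phi (eps_s D e x) y = \sw_(x, y <- D 1) phi x y.
Proof.
move=> pl.
transitivity (\sw_(x, z <- D 1) \sw_(u, v <- D 1) (e (x * v) *: phi u z)).
  apply: sw_ext => x y; rewrite eps_sE // (lin_swE _ _ (pl.1 y)).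
  by apply: sw_ext => u v; rewrite (linZ _ _ (pl.1 y)).
rewrite -(weak_unit_lr (T := fun u w z => e w *: phi u z)); last lin.
by apply: sw_ext => x z; apply: (counitr (f := phi^~ z)); lin.
Qed.

Lemma eps_t_leg2 W (phi : A -> A -> W) : bilinear_map phi ->
  \sw_(x, y <- D 1) phi x (eps_t D e y) = \sw_(x, y <- D 1) phi x y.
Proof.
move=> pl.
transitivity (\sw_(u, v <- D 1) \sw_(x, z <- D 1) (e (x * v) *: phi u z)).
  apply: sw_ext => x y; rewrite eps_tE // (lin_swE _ _ (pl.2 x)).
  by apply: sw_ext => u v; rewrite (linZ _ _ (pl.2 x)).
rewrite sw_swap -(weak_unit_lr (T := fun u w z => e w *: phi u z)); last lin.
by apply: sw_ext => x z; apply: (counitr (f := phi^~ z)); lin.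
Qed.

(** Both sides equal [eps_s(x_(1)) # x_(2)]. Writing [Delta(x) = Delta(1)(x # 1)] and [eps_s]
    through the antipode gives the left side; writing [Delta(x) = (x # 1)Delta(1)] and [eps_s]
    through the counit gives the right one. *)
Lemma target_slide1 x : target_like x -> mulT (tens (S x) 1) (D 1) = mulT (tens 1 x) (D 1).
Proof.
move=> xt; rewrite [LHS]tens_expand [RHS]tens_expand !sw_tensl; try lin.
transitivity (\sw_(a, b <- D x) tens (eps_s D e a) b).
  transitivity (\sw_(a, b <- D x) \sw_(p, q <- D a) tens (S p * q) b); last first.
    apply: sw_ext => a b; rewrite -Smul_eps_s.
    by rewrite (lin_swE (f := fun t => tens t b)) //; lin.
  rewrite (coassoc (T := fun a p q => tens (S a * p) q)); last lin.
  move: (xt 1).2; rewrite mul1r => ->; rewrite sw_tensr; last lin.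
  transitivity (\sw_(a, b <- D 1) \sw_(p, q <- D b) tens (S x * (S a * p)) q).
    rewrite -(coassoc (T := fun a p q => tens (S x * (S a * p)) q)); last lin.
    rewrite -(eps_s_leg1 (phi := fun a b => tens (S x * a) (1 * b))); last lin.
    apply: sw_ext => a b; rewrite -Smul_eps_s mul1r.
    by rewrite (lin_swE (f := fun t => tens (S x * t) b)) //; lin.
  apply: sw_ext => a b; rewrite mulr1; apply: sw_ext => p q.
  by rewrite SM mulrA.
move: (xt 1).1; rewrite mulr1 => ->; rewrite sw_tensl; last lin.
transitivity (\sw_(s, t <- D 1) \sw_(u, v <- D s) (e (x * v) *: tens u t)).
  rewrite (weak_unit_lr (T := fun u w z => e (x * w) *: tens u z)); last lin.
  apply: sw_ext => a b; rewrite mul1r eps_sE //.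
  rewrite (lin_swE (f := fun t => tens t b)); last lin.
  apply: sw_ext => u v; rewrite -mulrA (linZ (f := fun t => tens t b)) //; lin.
rewrite (coassoc (T := fun u v z => e (x * v) *: tens u z)); last lin.
apply: sw_ext => a b; rewrite mul1r.
rewrite -(counitl (f := fun t => tens a t)); last lin.
rewrite (xt b).1 sw_tensl; last lin.
by apply: sw_ext => u v; rewrite mul1r.
Qed.

Lemma target_slide x a : target_like x -> mulT (tens (S x) 1) (D a) = mulT (tens 1 x) (D a).
Proof. by move=> xt; rewrite -(DeltaE1l a) !mulTA target_slide1. Qed.

(** The mirror argument, with common value [y_(1) # eps_t(y_(2))]. *)
Lemma source_slide1 y : source_like y -> mulT (D 1) (tens y 1) = mulT (D 1) (tens 1 (S y)).
Proof.
move=> yt; rewrite [LHS]tens_expand [RHS]tens_expand !sw_tensr; try lin.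
transitivity (\sw_(a, b <- D y) tens a (eps_t D e b)); last first.
  transitivity (\sw_(a, b <- D y) \sw_(p, q <- D b) tens a (p * S q)).
    apply: sw_ext => a b; rewrite -mulS_eps_t.
    by rewrite (lin_swE (f := fun t => tens a t)) //; lin.
  rewrite -(coassoc (T := fun a p q => tens a (p * S q))); last lin.
  move: (yt 1).1; rewrite mulr1 => ->; rewrite sw_tensl; last lin.
  transitivity (\sw_(a, b <- D 1) \sw_(p, q <- D a) tens p (q * S b * S y)).
    apply: sw_ext => a b; rewrite mul1r; apply: sw_ext => p q.
    by rewrite SM mulrA.
  rewrite (coassoc (T := fun a p q => tens a (p * S q * S y))); last lin.
  rewrite -[RHS](eps_t_leg2 (phi := fun a b => tens (a * 1) (b * S y))); last lin.
  apply: sw_ext => a b; rewrite -mulS_eps_t mulr1.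
  by rewrite (lin_swE (f := fun t => tens a (t * S y))) //; lin.
move: (yt 1).2; rewrite mul1r => ->; rewrite sw_tensr; last lin.
transitivity (\sw_(s, t <- D 1) \sw_(u, v <- D s) (e (v * y) *: tens u t)); last first.
  rewrite (weak_unit_lr (T := fun u w z => e (w * y) *: tens u z)); last lin.
  rewrite sw_swap; apply: sw_ext => a b; rewrite mulr1 eps_tE //.
  rewrite (lin_swE (f := fun t => tens a t)); last lin.
  by apply: sw_ext => u v; rewrite mulrA (linZ (f := fun t => tens a t)) //; lin.
apply: sw_ext => a b; rewrite mulr1.
rewrite -(counitr (f := fun t => tens t b)); last lin.
rewrite (yt a).2 sw_tensr; last lin.
by apply: sw_ext => u v; rewrite mulr1.
Qed.

Lemma source_slide y a : source_like y -> mulT (D a) (tens y 1) = mulT (D a) (tens 1 (S y)).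
Proof. by move=> yt; rewrite -(DeltaE1r a) -!mulTA source_slide1. Qed.

(** Write [e(a S(y)) = e(1_(1)) e(a 1_(2) S(y))], slide [S(y)] over to the first leg as [y], and
    reassemble by the flipped counit axiom. *)
Lemma eps_source a y : source_like y -> e (a * S y) = e (a * y).
Proof.
move=> ys; rewrite -[in RHS](mulr1 a) epsM21.
transitivity (\sw_(u, v <- mulT (D 1) (tens 1 (S y))) (e u *: (e (a * v) : C^o))).
  rewrite sw_tensr; last lin.
  rewrite -[in LHS](mul1r (S y)).
  rewrite -(counitl (f := fun t => e (a * (t * S y)) : C^o)); last lin.
  by apply: (sw_ext (W := C^o)) => u v; rewrite mulr1.
rewrite -source_slide1 // sw_tensr; last lin.
by apply: (sw_ext (W := C^o)) => u v; rewrite mulr1; apply: mulrC.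
Qed.

Lemma eps_target a x : target_like x -> e (S x * a) = e (x * a).
Proof.
move=> xt; rewrite -[in RHS](mulr1 x) epsM21.
transitivity (\sw_(u, v <- mulT (tens (S x) 1) (D 1)) (e v *: (e (u * a) : C^o))).
  rewrite sw_tensl; last lin.
  rewrite -[in LHS](mulr1 (S x)).
  rewrite -(counitr (f := fun t => e (S x * t * a) : C^o)); last lin.
  by apply: (sw_ext (W := C^o)) => u v; rewrite mul1r.
rewrite target_slide1 // sw_tensl; last lin.
by apply: (sw_ext (W := C^o)) => u v; rewrite mul1r.
Qed.

Lemma target_likeV x : x \is a GRing.unit -> target_like x -> target_like x^-1.
Proof.
move=> xu xt a; split.
  by rewrite -[a in RHS](mulVKr xu) (xt _).1 mulTA mulT_tens mulVr // mulr1 mul1T.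
by rewrite -[a in RHS](mulrVK xu) (xt _).2 -mulTA mulT_tens mulrV // mulr1 mulT1.
Qed.

Lemma source_likeM x y : source_like x -> source_like y -> source_like (x * y).
Proof.
move=> xt yt a; split.
  by rewrite -mulrA (xt _).1 (yt _).1 mulTA mulT_tens mulr1.
by rewrite mulrA (yt _).2 (xt _).2 -mulTA mulT_tens mulr1.
Qed.

Lemma source_likeV x : x \is a GRing.unit -> source_like x -> source_like x^-1.
Proof.
move=> xu xs a; split.
  by rewrite -[a in RHS](mulVKr xu) (xs _).1 mulTA mulT_tens mulVr // mulr1 mul1T.
by rewrite -[a in RHS](mulrVK xu) (xs _).2 -mulTA mulT_tens mulrV // mulr1 mulT1.
Qed.

Definition modular_elt := \sw_(x, y <- D 1) (y * S x).

(** Sliding [x] from the second leg to the first turns [x 1_(2) S(1_(1))] into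
    [1_(2) S(S(x) 1_(1))]. *)
Lemma S2_target x : target_like x -> x * modular_elt = modular_elt * S (S x).
Proof.
move=> xt; rewrite /modular_elt (lin_swE (f := fun t => x * t)); last lin.
rewrite (lin_swE (f := fun t => t * S (S x))); last lin.
transitivity (\sw_(u, v <- mulT (tens 1 x) (D 1)) (v * S u)).
  by rewrite sw_tensl; [apply: sw_ext => u v; rewrite mul1r mulrA | lin].
rewrite -target_slide1 // sw_tensl; last lin.
by apply: sw_ext => u v; rewrite mul1r SM mulrA.
Qed.

Lemma S_modular_elt : S modular_elt = \sw_(x, y <- D 1) (S y * x).
Proof.
rewrite -[in RHS]S1 DeltaS; last lin.
by rewrite /modular_elt lin_swE //; apply: sw_ext => u v; rewrite SM.
Qed.

Lemma S2_source y : source_like y -> S modular_elt * y = S (S y) * S modular_elt.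
Proof.
move=> ys; rewrite S_modular_elt (lin_swE (f := fun t => t * y)); last lin.
rewrite (lin_swE (f := fun t => S (S y) * t)); last lin.
transitivity (\sw_(u, v <- mulT (D 1) (tens y 1)) (S v * u)).
  by rewrite sw_tensr; [apply: sw_ext => u v; rewrite mulr1 mulrA | lin].
rewrite source_slide1 // sw_tensr; last lin.
by apply: sw_ext => u v; rewrite mulr1 SM mulrA.
Qed.

(** * Inserting the inverse [g] of [h] into contractions of coproducts *)

Section Modular.
Variable g : A.
Hypothesis gt : target_like g.
Hypothesis gh : g * modular_elt = 1.

(* The double contraction X of Delta(1) is evaluated in two ways: absorbing
   1_(2) S(1_(1)) into the modular element gives 1, and sliding S(1_(1)) through
   the other copy of Delta(1) gives the contraction z itself. *)
Lemma modular_contraction : \sw_(u, v <- D 1) (S u * g * v) = 1.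
Proof.
set z := (X in X = 1).
(* Expanding [z = g h z] leaves [z] to the right of [1_(2) S(1_(1))]; this commutation moves it
   between the two factors, where its own copy of [Delta(1)] can meet the other one. *)
have zS p : source_like p -> z * S p = S p * z.
  move=> ps; rewrite /z (lin_swE (f := fun t => t * S p)); last lin.
  rewrite (lin_swE (f := fun t => S p * t)); last lin.
  transitivity (\sw_(u, v <- mulT (D 1) (tens 1 (S p))) (S u * g * v)).
    by rewrite sw_tensr; [apply: sw_ext => u v; rewrite mulr1 mulrA | lin].
  rewrite -source_slide1 // sw_tensr; last lin.
  by apply: sw_ext => u v; rewrite mulr1 SM !mulrA.
pose X := \sw_(u, v <- D 1) \sw_(p, q <- D 1) (g * q * g * v * (S u * S p)).
have X1 : X = 1.
  rewrite /X sw_swap.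
  rewrite -(eps_t_leg2 (phi := fun p q => \sw_(u, v <- D 1) (g * q * g * v * (S u * S p))));
  last lin.
  transitivity (\sw_(p, q <- D 1) (g * eps_t D e q * S p)).
    apply: sw_ext => p q; set Y := g * eps_t D e q.
    transitivity (Y * g * modular_elt * S p); last by rewrite -(mulrA Y) gh mulr1.
    rewrite [in RHS]/modular_elt (lin_swE (f := fun t => Y * g * t * S p)); last lin.
    by apply: sw_ext => u v; rewrite !mulrA.
  rewrite (eps_t_leg2 (phi := fun p q => g * q * S p)); last lin.
  rewrite -[RHS]gh /modular_elt (lin_swE (f := fun t => g * t)); last lin.
  by apply: sw_ext => u v; rewrite mulrA.
rewrite -X1 /X.
rewrite -(eps_s_leg1 (phi := fun u v => \sw_(p, q <- D 1) (g * q * g * v * (S u * S p)))); last lin.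
transitivity (\sw_(u, v <- D 1) \sw_(p, q <- D 1) (g * q * S (eps_s D e u) * g * v * S p)).
  rewrite (eps_s_leg1 (phi := fun u v => \sw_(p, q <- D 1) (g * q * S u * g * v * S p))); last lin.
  rewrite sw_swap.
  transitivity (\sw_(p, q <- D 1) (g * q * S (eps_s D e p) * z)).
    rewrite (eps_s_leg1 (phi := fun p q => g * q * S p * z)); last lin.
    transitivity (g * modular_elt * z); first by rewrite gh mul1r.
    rewrite -mulrA /modular_elt (lin_swE (f := fun t => g * (t * z))); last lin.
    by apply: sw_ext => p q; rewrite !mulrA.
  rewrite -(eps_s_leg1 (phi := fun p q => \sw_(u, v <- D 1) (g * q * S u * g * v * S p))); last lin.
  apply: sw_ext => p q; rewrite -mulrA -zS; last exact: source_like_eps_s.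
  rewrite /z (lin_swE (f := fun t => g * q * (t * S (eps_s D e p)))); last lin.
  by apply: sw_ext => u v; rewrite !mulrA.
apply: sw_ext => u v; set w := eps_s D e u.
have ws : source_like w by apply: source_like_eps_s.
transitivity (\sw_(p, q <- mulT (D 1) (tens 1 (S w))) (g * q * g * v * S p)).
  by rewrite sw_tensr; [apply: sw_ext => p q; rewrite mulr1 !mulrA | lin].
rewrite -source_slide1 // sw_tensr; last lin.
by apply: sw_ext => p q; rewrite mulr1 SM.
Qed.

(** Image of the previous contraction under [S], using that [Delta(1)] is invariant under [S # S]
    followed by the flip, since [S(1) = 1]. *)
Lemma modular_contractionS : \sw_(u, v <- D 1) (u * S g * S v) = 1.
Proof.
have := congr1 S modular_contraction; rewrite S1 lin_swE // => E.
rewrite -[RHS]E -[in LHS]S1 DeltaS; last lin.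
by apply: sw_ext => u v; rewrite !SM mulrA.
Qed.

(** Since [Delta(a) = Delta(1)Delta(a)], the middle of the product contains [S(1_(1)) g 1_(2)],
    which equals 1 just as [S(1_(1)) 1_(2)] does. *)
Lemma Smul_modular a : \sw_(u, v <- D a) (S u * g * v) = eps_s D e a.
Proof.
rewrite -Smul_eps_s -(DeltaE1l a) !sw_mulT; try lin.
rewrite sw_swap [RHS]sw_swap; apply: sw_ext => u v.
transitivity (S u * (\sw_(p, q <- D 1) (S p * g * q)) * v).
  rewrite (lin_swE (f := fun t => S u * t * v)); last lin.
  by apply: sw_ext => p q; rewrite SM !mulrA.
transitivity (S u * (\sw_(p, q <- D 1) (S p * q)) * v).
  rewrite modular_contraction Smul_eps_s.
  by rewrite eps_s1.
rewrite (lin_swE (f := fun t => S u * t * v)); last lin.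
by apply: sw_ext => p q; rewrite SM !mulrA.
Qed.

Lemma mulS_modular a : \sw_(u, v <- D a) (u * S g * S v) = eps_t D e a.
Proof.
rewrite -mulS_eps_t -(DeltaE1r a) !sw_mulT; try lin.
apply: sw_ext => u v.
transitivity (u * (\sw_(p, q <- D 1) (p * S g * S q)) * S v).
  rewrite (lin_swE (f := fun t => u * t * S v)); last lin.
  by apply: sw_ext => p q; rewrite SM !mulrA.
transitivity (u * (\sw_(p, q <- D 1) (p * S q)) * S v).
  rewrite modular_contractionS mulS_eps_t.
  by rewrite eps_t1.
rewrite (lin_swE (f := fun t => u * t * S v)); last lin.
by apply: sw_ext => p q; rewrite SM !mulrA.
Qed.

(** Write the right copy of [Delta(1)] as [S(y) # S(x)]. With [x] in [A_s], the factor
    [g S(x) = S(x S(g))] slides from the second leg of the left copy to the first as [x S(g)], and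
    the contraction [x S(g) S(y)] is 1. *)
Lemma Delta1_modular : source_like (S g) -> S (S g) = g ->
  mulT (mulT (D 1) (tens 1 g)) (D 1) = D 1.
Proof.
move=> sg ssg; rewrite [LHS]tens_expand sw_mulT; last lin.
rewrite sw_tensr; last lin.
rewrite sw_swap -[X in tcontract _ (D X)]S1 DeltaS; last lin.
rewrite -(eps_s_leg1 (phi := fun x y => \sw_(u, v <- D 1) tens (u * 1 * S y) (v * g * S x)));
  last lin.
transitivity (\sw_(x, y <- D 1) \sw_(u, v <- D 1) tens (u * (eps_s D e x * S g * S y)) v).
  apply: sw_ext => x y; set w := eps_s D e x.
  have ws : source_like w by apply: source_like_eps_s.
  transitivity (\sw_(u, v <- mulT (D 1) (tens 1 (S (w * S g)))) tens (u * S y) v).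
    rewrite sw_tensr; last lin.
    by apply: sw_ext => u v; rewrite SM ssg !mulr1 mulrA.
  rewrite -source_slide1; last exact: source_likeM.
  rewrite sw_tensr; last lin.
  by apply: sw_ext => u v; rewrite mulr1 !mulrA.
rewrite (eps_s_leg1 (phi := fun x y => \sw_(u, v <- D 1) tens (u * (x * S g * S y)) v)); last lin.
rewrite sw_swap [RHS]tens_expand; apply: sw_ext => u v.
transitivity (tens (u * \sw_(x, y <- D 1) (x * S g * S y)) v).
  by rewrite (lin_swE (f := fun t => tens (u * t) v)) //; lin.
by rewrite modular_contractionS mulr1.
Qed.

End Modular.

(** * The deformed structure *)

Section Deformation.
Variable k : A.
Hypothesis kAt : in_At D e k.
Hypothesis star_k : star k = k.
Hypothesis ku : k \is a GRing.unit.
Hypothesis k2 : k * k = modular_elt.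

Local Notation l := (k^-1).
Local Notation K := (S k).
Local Notation L := (S l).
Local Notation D' := (def_Delta D k).
Local Notation e' := (def_eps e S k).
Local Notation S' := (def_S S k).

Lemma k_target : target_like k.
Proof. by case: kAt => a ->; apply: target_like_eps_t. Qed.
Lemma l_target : target_like l.
Proof. exact: target_likeV k_target. Qed.

(** [k] commutes with its square [h], so [k h = h S^2(k)] can be cancelled. *)
Lemma S2k : S K = k.
Proof.
apply: (mulrI ku); apply: (mulrI ku).
by rewrite mulrA k2 -S2_target //; exact: k_target.
Qed.

Lemma KL : K * L = 1. Proof. by rewrite -SM mulVr // S1. Qed.
Lemma LK : L * K = 1. Proof. by rewrite -SM mulrV // S1. Qed.
Lemma S2l : S L = l.
Proof. by apply: (mulIr ku); rewrite -[X in _ * X]S2k -SM KL S1 mulVr. Qed.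

Lemma k_comm a : k * eps_s D e a = eps_s D e a * k.
Proof. by case: kAt => b {1 2}->; apply: eps_ts_comm. Qed.
Lemma l_comm a : l * eps_s D e a = eps_s D e a * l.
Proof.
apply: (mulrI ku); rewrite mulVKr //.
by rewrite mulrA k_comm -mulrA mulrV ?mulr1.
Qed.
Lemma K_eps_s : exists a, K = eps_s D e a.
Proof. by case: kAt => b ->; exists (S b); apply: S_eps_t. Qed.
Lemma K_comm a : K * eps_t D e a = eps_t D e a * K.
Proof. by case: K_eps_s => b ->; rewrite eps_ts_comm. Qed.
Lemma L_comm a : L * eps_t D e a = eps_t D e a * L.
Proof.
rewrite -[eps_t D e a in LHS]mulr1 -KL [in LHS](mulrA _ K) -K_comm.
by rewrite !mulrA LK mul1r.
Qed.

Lemma kK : k * K = K * k. Proof. by case: K_eps_s => b ->; rewrite k_comm. Qed.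
Lemma lK : l * K = K * l. Proof. by case: K_eps_s => b ->; rewrite l_comm. Qed.
Lemma kL : k * L = L * k. Proof. by case: kAt => b kb; have := L_comm b; rewrite -kb. Qed.
Lemma lL : l * L = L * l.
Proof. by rewrite -[in RHS](mulKr ku L) kL !mulrA mulrK. Qed.

(* Right-associated normal form, with K, L moved to the left of k, l. *)
Let kKA a : k * (K * a) = K * (k * a). Proof. by rewrite !mulrA kK. Qed.
Let kLA a : k * (L * a) = L * (k * a). Proof. by rewrite !mulrA kL. Qed.
Let lKA a : l * (K * a) = K * (l * a). Proof. by rewrite !mulrA lK. Qed.
Let lLA a : l * (L * a) = L * (l * a). Proof. by rewrite !mulrA lL. Qed.
Let KLA a : K * (L * a) = a. Proof. by rewrite mulrA KL mul1r. Qed.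
Let LKA a : L * (K * a) = a. Proof. by rewrite mulrA LK mul1r. Qed.
Let klA a : k * (l * a) = a. Proof. by rewrite mulVKr. Qed.
Let lkA a : l * (k * a) = a. Proof. by rewrite mulKr. Qed.
Let kl : k * l = 1. Proof. by rewrite mulrV. Qed.
Let lk : l * k = 1. Proof. by rewrite mulVr. Qed.
Let words := (kKA, kLA, lKA, lLA, KLA, LKA, klA, lkA, (kl, lk, KL, LK),
  (kK, kL, lK, lL), mul1r, mulr1).

Lemma Delta_l : mulT (tens l 1) (D 1) = mulT (D 1) (tens l 1).
Proof. by rewrite -(l_target 1).1 -(l_target 1).2 mul1r mulr1. Qed.

Lemma K_source : source_like K.
Proof. by case: K_eps_s => a ->; apply: source_like_eps_s. Qed.

Lemma L_source : source_like L.
Proof.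
have Ku : K \is a GRing.unit by apply/unitrP; exists L; rewrite KL LK.
have -> : L = K^-1 by rewrite -[RHS]mul1r -LK mulrK.
exact: source_likeV K_source.
Qed.

Lemma K_slidel a : mulT (tens K 1) (D a) = mulT (tens 1 k) (D a).
Proof. exact: target_slide k_target. Qed.
Lemma L_slidel a : mulT (tens L 1) (D a) = mulT (tens 1 l) (D a).
Proof. exact: target_slide l_target. Qed.
Lemma K_slider a : mulT (D a) (tens K 1) = mulT (D a) (tens 1 k).
Proof. by rewrite source_slide ?S2k //; exact: K_source. Qed.
Lemma L_slider a : mulT (D a) (tens L 1) = mulT (D a) (tens 1 l).
Proof. by rewrite source_slide ?S2l //; exact: L_source. Qed.

Lemma eps_K a : e (a * K) = e (a * k).
Proof. by rewrite -(eps_source _ K_source) S2k. Qed.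
Lemma epsK a : e (K * a) = e (k * a).
Proof. exact: eps_target k_target. Qed.

Lemma def_Delta_lin : is_linear D'.
Proof. rewrite /def_Delta; lin. Qed.
Lemma def_eps_lin : is_linear (e' : A -> C^o).
Proof. rewrite /def_eps; lin. Qed.
Lemma def_S_lin : is_linear S'.
Proof. rewrite /def_S; lin. Qed.
Let Dl' := def_Delta_lin.
Let el' := def_eps_lin.
Let Sl' := def_S_lin.

Lemma sw_def_Delta W (phi : A -> A -> W) a : bilinear_map phi ->
  tcontract phi (D' a) = \sw_(x, y <- D a) phi x (l * (y * l)).
Proof.
move=> pl; rewrite /def_Delta sw_tensl // sw_tensr; last lin.
by apply: sw_ext => x y; rewrite mul1r mulr1.
Qed.

(** As [l] is target-like, [Delta(l z l) = (l # 1)Delta(z)(l # 1)]: the outer pair of [l] lands on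
    the middle leg, where the other bracketing has it too. *)
Lemma def_coassoc a : tmap D' id (D' a) = tassoc (tmap id D' (D' a)).
Proof.
rewrite tmap_idrE tassoc_tmapE !sw_def_Delta; try lin.
transitivity (\sw_(x, z <- D a) \sw_(u, v <- D x)
    tens (tens u (l * (v * l))) (l * (z * l))).
  by apply: sw_ext => x z; rewrite sw_def_Delta //; lin.
rewrite (coassoc (T := fun u v z => tens (tens u (l * (v * l))) (l * (z * l)))); last lin.
apply: sw_ext => x z; rewrite sw_def_Delta; last lin.
rewrite (l_target _).1 (l_target _).2 sw_tensl; last lin.
rewrite sw_tensr; last lin.
by apply: sw_ext => u v; rewrite mul1r mulr1.
Qed.

Let ll_inv : l * l * modular_elt = 1.
Proof. by rewrite -k2 -!mulrA !words. Qed.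
Let ll_source : source_like (S (l * l)).
Proof. by rewrite SM; apply: source_likeM; apply: L_source. Qed.
Let S2ll : S (S (l * l)) = l * l. Proof. by rewrite !SM S2l. Qed.

Lemma def_DeltaM a b : D' (a * b) = mulT (D' a) (D' b).
Proof.
have E : mulT (mulT (D a) (tens 1 (l * l))) (D b) = mulT (D a) (D b).
  rewrite -{1}(DeltaE1r a) -{1}(DeltaE1l b) -(mulTA (D a)) mulTA -(mulTA (D a)).
  by rewrite (Delta1_modular ll_inv ll_source S2ll) DeltaE1r.
rewrite /def_Delta DeltaM -E !mulTA -(mulTA _ (tens 1 l) (tens 1 l)).
by rewrite mulT_tens mulr1.
Qed.

Let star_fd : is_fdCstar star. Proof. by case: H. Qed.

Lemma star_anti c x y : star (c *: x + y) = c^* *: star x + star y.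
Proof. by case: star_fd => E _ _ _; apply: E. Qed.
Lemma starM x y : star (x * y) = star y * star x.
Proof. by case: star_fd => _ E _ _; apply: E. Qed.
Lemma starK x : star (star x) = x.
Proof. by case: star_fd => _ _ E _; apply: E. Qed.
Lemma star1 : star 1 = 1.
Proof. by rewrite -[LHS]mulr1 -[X in _ * X]starK -starM mulr1 starK. Qed.

Lemma def_Delta_star a : D' (star a) = tstar star star (D' a).
Proof.
have sl : star l = l.
  by apply: (mulIr ku); rewrite -{2}star_k -starM mulrV // star1 mulVr.
have -> : D' (star a) = mulT (tens 1 l) (mulT (tstar star star (D a)) (tens 1 l)).
  by case: H => _ [_ _ _ E] _ _ _; rewrite /def_Delta E.
rewrite /def_Delta !(tstar_mulT star_anti starM) (tstar_tens star_anti).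
by rewrite star1 sl mulTA.
Qed.

(** In [e'(x) = e(k x K)] the factor [k] is absorbed into [Delta(k a)] and [K] slides to the second
    leg as [k]; there they cancel the two [l]. *)
Lemma def_counitl a : \sw_(x, y <- D' a) e' x *: y = a.
Proof.
rewrite sw_def_Delta; last lin.
transitivity (\sw_(x, y <- mulT (D (k * a)) (tens K 1)) e x *: (l * (y * l))).
  rewrite sw_tensr; last lin.
  rewrite (k_target _).1 sw_tensl; last lin.
  by apply: sw_ext => x y; rewrite mulr1 mul1r.
rewrite K_slider sw_tensr; last lin.
transitivity (l * (k * a * k * l)); last by rewrite -!mulrA !words.
rewrite -(counitl (f := fun y => l * (y * k * l))); last lin.
by apply: sw_ext => x y; rewrite mulr1.
Qed.

Lemma def_counitr a : \sw_(x, y <- D' a) e' y *: x = a.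
Proof.
rewrite sw_def_Delta; last lin.
transitivity (\sw_(x, y <- mulT (D (a * K)) (tens 1 l)) e y *: x).
  rewrite sw_tensr; last lin.
  rewrite (K_source _).2 sw_tensr; last lin.
  by apply: sw_ext => x y; rewrite /def_eps -!mulrA !words.
rewrite -L_slider sw_tensr; last lin.
transitivity (a * K * L); last by rewrite -!mulrA !words.
rewrite -(counitr (f := fun y => y * L)); last lin.
by apply: sw_ext => x y; rewrite mulr1.
Qed.

Lemma def_epsM12 f g h :
  e' (f * g * h) = \sw_(x, y <- D' g) (e' (f * x) * e' (y * h) : C^o).
Proof.
rewrite sw_def_Delta; last lin.
transitivity (e (k * f * g * (h * K))); first by rewrite /def_eps !mulrA.
rewrite epsM12.
(* [Delta(g)(K # l) = Delta(g)], because [K] slides to [k] on the second leg. This supplies the [K]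
   that [e'] needs in the first factor and the inner [l] of the second. *)
transitivity (\sw_(x, y <- mulT (mulT (D g) (tens K 1)) (tens 1 l))
   (e (k * f * x) * e (y * (h * K)) : C^o)).
  rewrite K_slider -mulTA mulT_tens kl mulr1.
  by rewrite mulT1.
rewrite !sw_tensr; try lin.
by apply: (sw_ext (W := C^o)) => x y; rewrite /def_eps -!mulrA !words.
Qed.

Lemma def_epsM21 f g h :
  e' (f * g * h) = \sw_(x, y <- D' g) (e' (f * y) * e' (x * h) : C^o).
Proof.
rewrite sw_def_Delta; last lin.
transitivity (e (k * f * g * (h * K))); first by rewrite /def_eps !mulrA.
rewrite epsM21.
(* Here the insertion stands on the left: [(K # l)Delta(g) = Delta(g)]. *)
transitivity (\sw_(x, y <- mulT (tens K l) (D g))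
   (e (k * f * y) * e (x * (h * K)) : C^o)).
  have -> : tens K l = mulT (tens 1 l) (tens K 1) by rewrite mulT_tens mul1r mulr1.
  by rewrite -mulTA K_slidel mulTA mulT_tens lk mulr1 mul1T.
rewrite !sw_tensl; try lin.
apply: (sw_ext (W := C^o)) => x y; rewrite /def_eps eps_K.
by rewrite -!mulrA !words epsK.
Qed.

Lemma def_weak_unit :
  tmap D' id (D' 1) = \sw_(x, z <- D 1) \sw_(u, v <- D x)
    tens (tens u (l * (v * l))) (l * (z * l)).
Proof.
rewrite tmap_idrE sw_def_Delta; last lin.
by apply: sw_ext => x z; rewrite sw_def_Delta //; lin.
Qed.

(** After the undeformed axiom the two sides differ only in whether [l] stands left or right of the
    first leg of one copy of [Delta(1)]; [Delta_l] says that this does not matter. *)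
Lemma def_weak_unit_lr :
  tmap D' id (D' 1) = mulT3 (tassoc (tens 1 (D' 1))) (tens (D' 1) 1).
Proof.
rewrite def_weak_unit mulT3_lE sw_def_Delta; last lin.
rewrite (weak_unit_lr (T := fun u v z => tens (tens u (l * (v * l))) (l * (z * l)))); last lin.
under [RHS]sw_ext => x z do (rewrite sw_def_Delta; last lin).
rewrite sw_swap [RHS]sw_swap; apply: sw_ext => u v.
have := congr1 (tcontract (fun x y => tens (tens u (x * (v * l))) (l * (y * l)))) Delta_l.
rewrite sw_tensl; last lin.
rewrite sw_tensr; last lin.
move=> E.
etransitivity; last (etransitivity; first exact: E).
  by apply: sw_ext => x y; rewrite mul1r !mulrA.
by apply: sw_ext => x y; rewrite mulr1 !mulrA.
Qed.

Lemma def_weak_unit_rl :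
  tmap D' id (D' 1) = mulT3 (tens (D' 1) 1) (tassoc (tens 1 (D' 1))).
Proof.
rewrite def_weak_unit mulT3_rE sw_def_Delta; last lin.
rewrite (weak_unit_rl (T := fun u v z => tens (tens u (l * (v * l))) (l * (z * l)))); last lin.
under [RHS]sw_ext => x z do (rewrite sw_def_Delta; last lin).
rewrite sw_swap [RHS]sw_swap; apply: sw_ext => u v.
have := congr1 (tcontract (fun x y => tens (tens u (l * v * x)) (l * (y * l)))) Delta_l.
rewrite sw_tensl; last lin.
rewrite sw_tensr; last lin.
move=> /esym E; etransitivity; last (etransitivity; first exact: E).
  by apply: sw_ext => x y; rewrite mulr1 !mulrA.
by apply: sw_ext => x y; rewrite mul1r !mulrA.
Qed.

Lemma def_S1 : S' 1 = 1.
Proof. by rewrite /def_S S1 -!mulrA !words. Qed.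

Lemma def_SM a b : S' (a * b) = S' b * S' a.
Proof. by rewrite /def_S SM -!mulrA !words. Qed.

Lemma def_epsE a : e' a = e (k * a * k).
Proof. by rewrite /def_eps eps_K. Qed.

Lemma def_eps_sym a : e (k * a * K) = e (K * a * k).
Proof. by rewrite eps_K -!mulrA epsK. Qed.

Lemma def_eps_S a : e' (S' a) = e' a.
Proof.
rewrite /def_eps def_eps_sym /def_S -!mulrA !words -[in RHS]epsS !SM S2k.
by rewrite !mulrA.
Qed.

Lemma def_DeltaS a : D' (S' a) = tflip (tmap S' S' (D' a)).
Proof.
rewrite [LHS]tens_expand [RHS]tens_expand sw_tflip; last lin.
rewrite sw_tmap; last lin.
rewrite !sw_def_Delta; try lin.
(* In [S'(a) = L k S(a) l K] the target-like [k], [l] go to the first leg and the source-like [L],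
   [K] to the second. *)
have -> : D (S' a) = mulT (tens k L) (mulT (D (S a)) (tens l K)).
  rewrite /def_S -!mulrA (L_source _).1 (k_target _).1 mulTA mulT_tens mul1r mulr1.
  rewrite mulrA (K_source _).2 (l_target _).2 -mulTA mulT_tens mul1r mulr1 //.
rewrite sw_tensl; last lin.
rewrite sw_tensr; last lin.
(* The discrepancy left between the two sides. Both tensors act on [Delta(S(a))] as [L # L], by
   trading [L] on the first leg for [l] on the second. *)
have E : mulT (tens 1 (L * l)) (D (S a)) = mulT (tens (L * L) (L * k)) (D (S a)).
  transitivity (mulT (tens L L) (D (S a))).
    have -> : tens L L = mulT (tens 1 L) (tens L 1) by rewrite mulT_tens mul1r mulr1.
    by rewrite -mulTA L_slidel mulTA mulT_tens mulr1.
  have -> : tens (L * L) (L * k) = mulT (tens L (L * k)) (tens L 1).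
    by rewrite mulT_tens mulr1.
  by rewrite -mulTA L_slidel mulTA mulT_tens mulr1 -mulrA kl mulr1.
move/(congr1 (tcontract (fun x y => tens (k * (x * l)) (y * (K * l))))): E.
rewrite !sw_tensl; try lin.
move=> E; transitivity (\sw_(x, y <- D (S a)) tens (L * k * L * x * L * l * K) (L * k * y * l * K)).
  etransitivity; last (etransitivity; first exact: E).
    by apply: sw_ext => x y; rewrite -!mulrA !words.
  by apply: sw_ext => x y; rewrite -!mulrA !words.
rewrite DeltaS; last lin.
by apply: sw_ext => x y; rewrite /def_S !SM -!mulrA !words.
Qed.

(** The [K] from [e'] slides to the second leg as [k] and cancels the left [l]. The deformed [eps_t]
    thus takes its values in [A_t l], which reduces the antipode axiom and regularity to facts about
    [A_t]. *)
Lemma def_eps_tE a : eps_t D' e' a = eps_t D e (a * K) * l.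
Proof.
rewrite eps_tE // sw_def_Delta; last lin.
transitivity (\sw_(x, y <- mulT (tens K 1) (D 1)) e (x * (a * K)) *: (l * (y * l))).
  rewrite sw_tensl; last lin.
  by apply: sw_ext => x y; rewrite /def_eps -!mulrA !words epsK.
rewrite K_slidel sw_tensl; last lin.
rewrite eps_tE // (lin_swE (f := fun t => t * l)); last lin.
by apply: sw_ext => x y; rewrite -!mulrA !words scalerAl.
Qed.

Lemma def_eps_sE a : eps_s D' e' a = L * eps_s D e (k * a).
Proof.
rewrite eps_sE // sw_def_Delta; last lin.
transitivity (\sw_(x, y <- mulT (tens 1 l) (D 1)) e (k * a * y) *: x).
  rewrite sw_tensl; last lin.
  by apply: sw_ext => x y; rewrite def_epsE -!mulrA !words.
rewrite -L_slidel sw_tensl; last lin.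
rewrite eps_sE // (lin_swE (f := fun t => L * t)); last lin.
by apply: sw_ext => x y; rewrite mul1r scalerAr.
Qed.

(** Expanding [S'] leaves [L L = S(l l)] between [x] and the image of [y], which is the insertion
    that [mulS_modular] removes for [g = l l = h^-1]; the remaining [k = S(K)] comes from
    [Delta(a K)]. *)
Lemma def_mulS a : \sw_(x, y <- D' a) (x * S' y) = eps_t D' e' a.
Proof.
rewrite def_eps_tE -(mulS_modular ll_inv) (K_source _).2 sw_tensr; last lin.
rewrite (lin_swE (f := fun t => t * l)); last lin.
rewrite sw_def_Delta; last lin.
by apply: sw_ext => x y; rewrite /def_S !SM S2k -!mulrA !words.
Qed.

Lemma def_Smul a : \sw_(x, y <- D' a) (S' x * y) = eps_s D' e' a.
Proof.
rewrite def_eps_sE sw_def_Delta; last lin.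
transitivity (L * k * eps_s D e (k * a) * l); last by rewrite -!mulrA -l_comm !words.
rewrite -(Smul_modular ll_inv) (k_target _).1 sw_tensl; last lin.
rewrite (lin_swE (f := fun t => L * k * t * l)); last lin.
by apply: sw_ext => x y; rewrite /def_S !SM -!mulrA !words.
Qed.

Lemma def_SmulmulS a : tcontract (fun M z => \sw_(x, y <- M) (S' x * y * S' z))
  (tmap D' id (D' a)) = S' a.
Proof.
rewrite sw_sw.
(* The deformed triple product at [a], rewritten at [k a]: up to outer factors it is the undeformed
   one with [h^-1] and [S(h^-1)] inserted. The insertions are removed one at a time, regrouping by
   coassociativity in between. *)
pose T u v z := L * k * (S u * (l * l) * v * S (l * l) * S z) * l.
transitivity (\sw_(x, z <- D (k * a)) \sw_(u, v <- D x) T u v z).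
  transitivity (\sw_(x, z <- D a) \sw_(u, v <- D x) (T (k * u) v z)).
    rewrite sw_def_Delta; last lin.
    apply: sw_ext => x z; rewrite sw_tens; last lin.
    rewrite sw_def_Delta; last lin.
    by apply: sw_ext => u v; rewrite /T /def_S !SM -!mulrA !words.
  rewrite (k_target _).1 sw_tensl; last (rewrite /T; lin).
  apply: sw_ext => x z; rewrite (k_target _).1 sw_tensl; last (rewrite /T; lin).
  by apply: sw_ext => u v; rewrite !mul1r.
transitivity (L * k * S (k * a) * l); last first.
  by rewrite /def_S SM -!mulrA !words.
rewrite -(SmulmulS (k * a)) (lin_swE (f := fun t => L * k * t * l)); last lin.
transitivity (\sw_(x, z <- D (k * a)) (L * k * (eps_s D e x * S (l * l) * S z) * l)).
  apply: sw_ext => x z; rewrite -(Smul_modular ll_inv).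
  rewrite (lin_swE (f := fun t => L * k * (t * S (l * l) * S z) * l)); last lin.
  by [].
transitivity (\sw_(x, z <- D (k * a)) \sw_(u, v <- D x) (L * k * (S u * v * S (l * l) * S z) * l)).
  apply: sw_ext => x z; rewrite -Smul_eps_s.
  by rewrite (lin_swE (f := fun t => L * k * (t * S (l * l) * S z) * l)) //; lin.
rewrite (coassoc (T := fun u v z => L * k * (S u * v * S (l * l) * S z) * l)); last lin.
transitivity (\sw_(x, z <- D (k * a)) (L * k * (S x * eps_t D e z) * l)).
  apply: sw_ext => x z; rewrite -(mulS_modular ll_inv).
  rewrite (lin_swE (f := fun t => L * k * (S x * t) * l)); last lin.
  by apply: sw_ext => u v; rewrite -!mulrA.
transitivity (\sw_(x, z <- D (k * a)) \sw_(u, v <- D z) (L * k * (S x * u * S v) * l)).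
  apply: sw_ext => x z; rewrite -mulS_eps_t.
  rewrite (lin_swE (f := fun t => L * k * (S x * t) * l)); last lin.
  by apply: sw_ext => u v; rewrite -!mulrA.
rewrite -(coassoc (T := fun u v z => L * k * (S u * v * S z) * l)); last lin.
apply: sw_ext => x z.
by rewrite (lin_swE (f := fun t => L * k * t * l)) //; lin.
Qed.

Lemma def_CQG : is_CQG star D' e' S'.
Proof.
split=> //.
- split; [exact: Dl' | exact: def_coassoc | exact: def_DeltaM | exact: def_Delta_star].
- split; [exact: el' | exact: def_counitl | exact: def_counitr | exact: def_epsM12
    | exact: def_epsM21].
- split; [exact: def_weak_unit_lr | exact: def_weak_unit_rl].
split; [exact: Sl' | split; [exact: def_S1 | exact: def_SM]
  | split; [exact: def_DeltaS | exact: def_eps_S]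
  | split; [exact: def_mulS | exact: def_Smul] | exact: def_SmulmulS].
Qed.

Lemma def_S2 a : S' (S' a) = L * L * (k * k) * S (S a) * (l * l) * (K * K).
Proof. by rewrite /def_S !SM S2k S2l -!mulrA !words. Qed.

(** On [A_t] one has [S^2(t) = l^2 t k^2], and [K], [L] commute with [t], so the conjugations in
    [def_S2] cancel. On [A_s] the roles are exchanged: [S^2(s) = K^2 s L^2], and [k] commutes with
    [s]. *)
Lemma def_regular : is_regular D' e' S'.
Proof.
split=> a [g ->].
  rewrite def_eps_tE; set t := eps_t D e _; rewrite def_S2 !SM S2l.
  have tt : S (S t) = l * l * t * (k * k).
    apply: (mulrI ku); apply: (mulrI ku).
    rewrite mulrA k2 -S2_target; last exact: target_like_eps_t.
    by rewrite -k2 -!mulrA !words.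
  have Kt : t * K = K * t by rewrite /t K_comm.
  rewrite tt -!mulrA !words.
  by do 2![rewrite (mulrA t K) Kt -!mulrA !words].
rewrite def_eps_sE; set s := eps_s D e _; rewrite def_S2 !SM S2l.
have ss : S (S s) = K * K * s * (L * L).
  have := S2_source (source_like_eps_s (k * g)); rewrite -k2 SM => ->.
  by rewrite -!mulrA !words.
have ks : k * s = s * k by rewrite /s k_comm.
rewrite ss -!mulrA !words.
by do 2![rewrite (mulrA k s) ks -!mulrA !words].
Qed.

End Deformation.
End WeakHopf.

(** * Separating families of functionals on tensor products *)

Section Separation.
Variable C : numClosedFieldType.
Implicit Types U V W : vectType C.

Definition separating U (I : Type) (f : I -> U -> C) :=
  (forall i, is_linear (f i : U -> C^o)) /\ forall u, (forall i, f i u = 0) -> u = 0.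

Lemma separating_eq U I (f : I -> U -> C) u v :
  separating f -> (forall i, f i u = f i v) -> u = v.
Proof.
case=> fl fs E; apply/eqP; rewrite -subr_eq0 addrC; apply/eqP/fs => i.
by have := fl i (-1) v u; rewrite scaleN1r => ->; rewrite E scaleN1r addNr.
Qed.

(** Contracting the first leg with [f i] gives a vector killed by every [g j], hence 0; so each
    coordinate taken in the second leg leaves a vector killed by every [f i], and all entries of [X]
    vanish. *)
Lemma separating_tens U V I J (f : I -> U -> C) (g : J -> V -> C) :
  separating f -> separating g ->
  separating (fun (ij : I * J) (X : 'T[C]_(U, V)) =>
    \sw_(x, y <- X) (f ij.1 x * g ij.2 y : C^o)).
Proof.
move=> [fl fs] [gl gs]; split=> [ij | X X0]; first exact: sw_lin.
have v0 i : \sw_(x, y <- X) f i x *: y = 0.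
  apply: gs => j; have gj := gl j.
  by rewrite (lin_swE _ _ gj) -[RHS](X0 (i, j)); apply: (sw_ext (W := C^o)) => x y; rewrite (linZ _ _ gj).
have u0 b : \sw_(x, y <- X) crd b y *: x = 0.
  apply: fs => i; have fi := fl i; have cb := crd_lin b.
  rewrite (lin_swE _ _ fi) -[RHS](lin0 cb) -(v0 i) (lin_swE _ _ cb).
  by apply: (sw_ext (W := C^o)) => x y; rewrite (linZ _ _ fi) (linZ _ _ cb); apply: mulrC.
apply/matrixP => a b; have ca := crd_lin a.
transitivity ((\sw_(x, y <- X) tens x y) a b); first by rewrite -tens_expand.
rewrite [RHS]mxE -[RHS](lin0 ca) -(u0 b) (lin_swE _ _ ca).
have El : is_linear ((fun M : 'T[C]_(U, V) => M a b) : _ -> C^o).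
  by move=> c M N; rewrite !mxE.
rewrite (lin_swE _ _ El); apply: (sw_ext (W := C^o)) => x y.
by rewrite (linZ _ _ ca) mxE; apply: mulrC.
Qed.

Lemma sw_cmul U V U' V' (F : U -> V -> C) (G : U' -> V' -> C) X Y :
  (\sw_(x, y <- X) (F x y : C^o)) * (\sw_(u, v <- Y) (G u v : C^o)) =
  \sw_(x, y <- X) \sw_(u, v <- Y) (F x y * G u v : C^o) :> C.
Proof.
rewrite (lin_swE (f := (fun t => t * _) : C^o -> C^o)); last lin.
apply: (sw_ext (W := C^o)) => x y.
by rewrite (lin_swE (f := (fun t => F x y * t) : C^o -> C^o)) //; lin.
Qed.

Lemma sw_swap22 U1 V1 U2 V2 U3 V3 U4 V4 W
    (T : U1 -> V1 -> U2 -> V2 -> U3 -> V3 -> U4 -> V4 -> W) X1 X3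
    (X2 : U1 -> V1 -> 'T[C]_(U2, V2)) (X4 : U3 -> V3 -> 'T[C]_(U4, V4)) :
  \sw_(a, b <- X1) \sw_(c, d <- X2 a b) \sw_(x, y <- X3) \sw_(u, v <- X4 x y)
    T a b c d x y u v =
  \sw_(x, y <- X3) \sw_(u, v <- X4 x y) \sw_(a, b <- X1) \sw_(c, d <- X2 a b)
    T a b c d x y u v.
Proof.
transitivity (\sw_(a, b <- X1) \sw_(x, y <- X3) \sw_(u, v <- X4 x y) \sw_(c, d <- X2 a b)
    T a b c d x y u v).
  apply: sw_ext => a b; rewrite sw_swap; apply: sw_ext => x y; exact: sw_swap.
rewrite sw_swap; apply: sw_ext => x y; exact: sw_swap.
Qed.

Lemma tpairE (A B : vectType C) (p : A -> B -> C) X Y : 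
  tpair p X Y = \sw_(x, y <- X) \sw_(u, v <- Y) (p x u * p y v : C^o).
Proof.
apply: eq_bigr => i _; apply: eq_bigr => j _.
rewrite scaler_sumr; apply: eq_bigr => k _.
rewrite scaler_sumr; apply: eq_bigr => l _.
by rewrite /GRing.scale /= !mulrA.
Qed.

End Separation.

(** * Duality of weak Hopf structures *)

Section Duality.
Variables (C : numClosedFieldType) (A B : falgType C).
Variables (starA : A -> A) (DA : A -> 'T[C]_(A, A)) (eA : A -> C) (SA : A -> A).
Variables (starB : B -> B) (DB : B -> 'T[C]_(B, B)) (eB : B -> C) (SB : B -> B).
Variable q : A -> B -> C.
Hypothesis HA : is_CQG starA DA eA SA.
Hypothesis starB_fd : is_fdCstar starB.
Hypothesis Hq : is_dual_pair starA DA eA SA starB DB eB SB q.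

Lemma pairing_bilin : bilinear_map (q : A -> B -> C^o).
Proof. by case: Hq => [[ql qr] _ _ _ _]; split. Qed.
Let qlin := pairing_bilin.
Let DAl := Delta_lin HA.
Let eAl := eps_lin HA.
Let SAl := S_lin HA.

Lemma sepB : separating (fun a b => q a b).
Proof. by case: Hq => [[_ ql] [_ q0] _ _ _]; split. Qed.

Lemma sepA : separating (fun b a => q a b).
Proof. by case: Hq => [[ql _] [q0 _] _ _ _]; split. Qed.

Lemma sepBB : separating (fun aa (X : 'T[C]_(B, B)) =>
  \sw_(x, y <- X) (q aa.1 x * q aa.2 y : C^o)).
Proof. exact: separating_tens sepB sepB. Qed.

Lemma sepBBB (X Y : 'T[C]_('T[C]_(B, B), B)) :
  (forall a b c, contr3 (fun x y z => q a x * q b y * q c z : C^o) X =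
     contr3 (fun x y z => q a x * q b y * q c z : C^o) Y) -> X = Y.
Proof.
move=> E; apply: (separating_eq (separating_tens sepBB sepB)) => -[[a b] c] /=.
have e Z : contr3 (fun x y z => q a x * q b y * q c z : C^o) Z =
    \sw_(M, z <- Z) ((\sw_(x, y <- M) (q a x * q b y : C^o)) * q c z : C^o).
  apply: (sw_ext (W := C^o)) => M z.
  by rewrite (lin_swE (f := (fun t => t * q c z) : C^o -> C^o)) //; lin.
by rewrite -!e.
Qed.

Lemma pair_mulA a a' b : q (a * a') b = \sw_(x, y <- DB b) (q a x * q a' y : C^o).
Proof.
case: Hq => _ _ [_ E] _ _; rewrite E tpairE (sw_tens (W := C^o)) //.
split=> [v | u]; lin.
Qed.

Lemma pair_mulB a b c : q a (b * c) = \sw_(x, y <- DA a) (q x b * q y c : C^o).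
Proof.
case: Hq => _ _ [E _] _ _; rewrite E tpairE; apply: (sw_ext (W := C^o)) => x y.
by rewrite (sw_tens (W := C^o)) //; lin.
Qed.

Lemma pair1B a : q a 1 = eA a. Proof. by case: Hq => _ _ _ []. Qed.
Lemma pair1A b : q 1 b = eB b. Proof. by case: Hq => _ _ _ []. Qed.
Lemma pairS a b : q (SA a) b = q a (SB b). Proof. by case: Hq => _ _ _ _ []. Qed.
Lemma pair_star a b : q (starA a) b = (q a (starB (SB b)))^*.
Proof. by case: Hq => _ _ _ _ []. Qed.

Lemma starBK b : starB (starB b) = b.
Proof. by case: starB_fd. Qed.

(** The star axiom of the pairing, used twice, transposes the identity [a** = a] to the square of
    [b |-> S(b)^*]. *)
Lemma star_S_starB b : starB (SB (starB (SB b))) = b.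
Proof.
apply: (separating_eq sepB) => a.
by rewrite -[LHS]conjCK -pair_star -pair_star (starK HA).
Qed.

Lemma S_star_SB b : SB (starB (SB b)) = starB b.
Proof. by rewrite -[LHS]starBK star_S_starB. Qed.

Lemma star_S_starA a : starA (SA (starA (SA a))) = a.
Proof.
apply: (separating_eq sepA) => b.
by rewrite pair_star pairS S_star_SB pair_star conjCK pairS S_star_SB starBK.
Qed.

Lemma pair_starB a b : q a (starB b) = (q (starA (SA a)) b)^*.
Proof. by rewrite pair_star conjCK pairS S_star_SB. Qed.

Let sepBBeq (X Y : 'T[C]_(B, B)) : (forall a a',
  \sw_(x, y <- X) (q a x * q a' y : C^o) = \sw_(x, y <- Y) (q a x * q a' y : C^o)) ->
  X = Y.
Proof. by move=> E; apply: (separating_eq sepBB) => -[a a']; apply: E. Qed.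

Lemma dual_Delta_lin : is_linear DB.
Proof.
move=> c b b'; apply: sepBBeq => a a'.
rewrite -pair_mulA (qlin.2 _) !pair_mulA.
by rewrite (sw_lin (W := C^o) _ c (DB b) (DB b')).
Qed.

Lemma dual_eps_lin : is_linear (V := C^o) eB.
Proof. by move=> c b b'; rewrite -!pair1A (qlin.2 _). Qed.

Lemma dual_S_lin : is_linear SB.
Proof.
move=> c b b'; apply: (separating_eq sepB) => a.
by rewrite -pairS !(qlin.2 _) -!pairS.
Qed.

Let DBl := dual_Delta_lin.
Let eBl := dual_eps_lin.
Let SBl := dual_S_lin.

Let sw_mul2r (U V : vectType C) (F : U -> V -> C) X (c : C) :
  (\sw_(x, y <- X) (F x y : C^o)) * c = \sw_(x, y <- X) (F x y * c : C^o).
Proof. by rewrite (lin_swE (f := (fun t => t * c) : C^o -> C^o)) //; lin. Qed.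
Let sw_mul2l (U V : vectType C) (F : U -> V -> C) X (c : C) :
  c * (\sw_(x, y <- X) (F x y : C^o)) = \sw_(x, y <- X) (c * F x y : C^o).
Proof. by rewrite (lin_swE (f := (fun t => c * t) : C^o -> C^o)) //; lin. Qed.

Let tri_qqq a b c : trilinear_map (Z := C^o) (fun x y z => q a x * q b y * q c z).
Proof. lin. Qed.

Lemma dual_coassoc b : tmap DB id (DB b) = tassoc (tmap id DB (DB b)).
Proof.
rewrite tmap_idrE tassoc_tmapE; apply: sepBBB => a1 a2 a3.
rewrite (contr3_sw2 (fun _ _ x _ => x) (fun _ _ _ y => y) (fun _ v _ _ => v)) //.
rewrite (contr3_sw2 (fun u _ _ _ => u) (fun _ _ x _ => x) (fun _ _ _ y => y)) //.
transitivity (q (a1 * a2 * a3) b).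
  rewrite pair_mulA; apply: (sw_ext (W := C^o)) => u v.
  by rewrite pair_mulA sw_mul2r.
rewrite -mulrA pair_mulA; apply: (sw_ext (W := C^o)) => u v.
rewrite pair_mulA sw_mul2l; apply: (sw_ext (W := C^o)) => x y.
by rewrite mulrA.
Qed.

Lemma dual_DeltaM b c : DB (b * c) = mulT (DB b) (DB c).
Proof.
apply: sepBBeq => a a'; rewrite -pair_mulA pair_mulB (DeltaM HA).
rewrite (sw_mulT (W := C^o)); last lin.
rewrite (sw_mulT (W := C^o)); last lin.
transitivity (\sw_(r, s <- DA a) \sw_(r', s' <- DA a') \sw_(x, y <- DB b)
  \sw_(u, v <- DB c) (q r x * q r' y * (q s u * q s' v) : C^o)).
  apply: (sw_ext (W := C^o)) => r s; apply: (sw_ext (W := C^o)) => r' s'.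
  by rewrite !pair_mulA sw_cmul.
rewrite sw_swap22; apply: (sw_ext (W := C^o)) => x y.
apply: (sw_ext (W := C^o)) => u v; rewrite !pair_mulB sw_cmul.
apply: (sw_ext (W := C^o)) => r s; apply: (sw_ext (W := C^o)) => r' s'.
by rewrite mulrACA.
Qed.

(** The star of [B] is transposed to [a |-> S(a)^*], which is multiplicative because [S] and the
    involution both reverse products. *)
Lemma dual_Delta_star b : DB (starB b) = tstar starB starB (DB b).
Proof.
apply: sepBBeq => a a'; rewrite -pair_mulA pair_starB (SM HA).
have qq : bilinear_map ((fun x y => q a x * q a' y) : B -> B -> C^o) by lin.
rewrite (starM HA) pair_mulA tcontract_pair rmorph_sum tstarE (lin_sum _ _ _ (sw_lin _)).
apply: eq_bigr => p _; rewrite (linZ _ _ (sw_lin _)) (sw_tens _ _ qq).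
by rewrite /GRing.scale /= !rmorphM !pair_starB.
Qed.

Lemma dual_counitl b : \sw_(x, y <- DB b) eB x *: y = b.
Proof.
apply: (separating_eq sepB) => a; have qa := qlin.2 a.
rewrite (lin_swE _ _ qa) -[in RHS](mul1r a) pair_mulA.
by apply: (sw_ext (W := C^o)) => x y; rewrite (linZ _ _ qa) pair1A.
Qed.

Lemma dual_counitr b : \sw_(x, y <- DB b) eB y *: x = b.
Proof.
apply: (separating_eq sepB) => a; have qa := qlin.2 a.
rewrite (lin_swE _ _ qa) -[in RHS](mulr1 a) pair_mulA.
by apply: (sw_ext (W := C^o)) => x y; rewrite (linZ _ _ qa) pair1A; apply: mulrC.
Qed.

(** Transpose of the weak unit axiom of [A], tested on [f # g # h]: the product in the middle leg
    splits along [Delta(g)]. The order of its factors decides between this form and the flipped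
    one. *)
Lemma dual_epsM12 f g h :
  eB (f * g * h) = \sw_(x, y <- DB g) (eB (f * x) * eB (y * h) : C^o).
Proof.
transitivity (\sw_(x, z <- DA 1) \sw_(u, v <- DA x) (q u f * q v g * q z h : C^o)).
  rewrite -pair1A pair_mulB; apply: (sw_ext (W := C^o)) => x z.
  by rewrite pair_mulB sw_mul2r.
rewrite (weak_unit_rl HA (W := C^o) (T := fun u v z => q u f * q v g * q z h)); last lin.
transitivity (\sw_(x, z <- DA 1) \sw_(u, v <- DA 1) \sw_(r, s <- DB g) 
  (q u f * q v r * (q x s * q z h) : C^o)).
  apply: (sw_ext (W := C^o)) => x z; apply: (sw_ext (W := C^o)) => u v.
  rewrite pair_mulA sw_mul2l sw_mul2r; apply: (sw_ext (W := C^o)) => r s.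
  by rewrite !mulrA.
transitivity (\sw_(r, s <- DB g) \sw_(x, z <- DA 1) \sw_(u, v <- DA 1)
  (q u f * q v r * (q x s * q z h) : C^o)).
  rewrite [RHS]sw_swap; apply: (sw_ext (W := C^o)) => x z; exact: sw_swap.
apply: (sw_ext (W := C^o)) => r s.
by rewrite sw_swap -!pair1A !pair_mulB sw_cmul.
Qed.

Lemma dual_epsM21 f g h :
  eB (f * g * h) = \sw_(x, y <- DB g) (eB (f * y) * eB (x * h) : C^o).
Proof.
transitivity (\sw_(x, z <- DA 1) \sw_(u, v <- DA x) (q u f * q v g * q z h : C^o)).
  rewrite -pair1A pair_mulB; apply: (sw_ext (W := C^o)) => x z.
  by rewrite pair_mulB sw_mul2r.
rewrite (weak_unit_lr HA (W := C^o) (T := fun u v z => q u f * q v g * q z h)); last lin.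
transitivity (\sw_(x, z <- DA 1) \sw_(u, v <- DA 1) \sw_(r, s <- DB g) 
  (q u f * q v s * (q x r * q z h) : C^o)).
  apply: (sw_ext (W := C^o)) => x z; apply: (sw_ext (W := C^o)) => u v.
  rewrite pair_mulA sw_mul2l sw_mul2r; apply: (sw_ext (W := C^o)) => r s.
  by rewrite (mulrC (q x r)) !mulrA.
transitivity (\sw_(r, s <- DB g) \sw_(x, z <- DA 1) \sw_(u, v <- DA 1)
  (q u f * q v s * (q x r * q z h) : C^o)).
  rewrite [RHS]sw_swap; apply: (sw_ext (W := C^o)) => x z; exact: sw_swap.
apply: (sw_ext (W := C^o)) => r s.
by rewrite sw_swap -!pair1A !pair_mulB sw_cmul.
Qed.

Lemma dual_Delta1 a1 a2 a3 :
  contr3 (Z := C^o) (fun x y z => q a1 x * q a2 y * q a3 z) (tmap DB id (DB 1)) =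
  eA (a1 * a2 * a3).
Proof.
rewrite tmap_idrE.
rewrite (contr3_sw2 (fun _ _ x _ => x) (fun _ _ _ y => y) (fun _ v _ _ => v)) //.
rewrite -pair1B pair_mulA; apply: (sw_ext (W := C^o)) => u v.
by rewrite pair_mulA sw_mul2r.
Qed.

Lemma dual_weak_unit_lr :
  tmap DB id (DB 1) = mulT3 (tassoc (tens 1 (DB 1))) (tens (DB 1) 1).
Proof.
apply: sepBBB => a1 a2 a3; rewrite dual_Delta1 mulT3_lE.
rewrite (contr3_sw2 (fun _ _ u _ => u) (fun x _ _ v => x * v) (fun _ y _ _ => y)) //.
rewrite (epsM21 HA).
transitivity (\sw_(r, s <- DA a2) \sw_(x, y <- DB 1) \sw_(u, v <- DB 1)
  (q a1 u * (q r x * q s v) * q a3 y : C^o)).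
  apply: (sw_ext (W := C^o)) => r s.
  rewrite -!pair1B !pair_mulA sw_cmul sw_swap; apply: (sw_ext (W := C^o)) => x y.
  apply: (sw_ext (W := C^o)) => u v; rewrite -!mulrA; congr (_ * _).
  by rewrite mulrCA.
transitivity (\sw_(x, y <- DB 1) \sw_(u, v <- DB 1) \sw_(r, s <- DA a2)
  (q a1 u * (q r x * q s v) * q a3 y : C^o)).
  rewrite sw_swap; apply: (sw_ext (W := C^o)) => x z; exact: sw_swap.
apply: (sw_ext (W := C^o)) => x y; apply: (sw_ext (W := C^o)) => u v.
by rewrite pair_mulB sw_mul2l sw_mul2r.
Qed.

Lemma dual_weak_unit_rl :
  tmap DB id (DB 1) = mulT3 (tens (DB 1) 1) (tassoc (tens 1 (DB 1))).
Proof.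
apply: sepBBB => a1 a2 a3; rewrite dual_Delta1 mulT3_rE.
rewrite (contr3_sw2 (fun _ _ u _ => u) (fun x _ _ v => v * x) (fun _ y _ _ => y)) //.
rewrite (epsM12 HA).
transitivity (\sw_(r, s <- DA a2) \sw_(x, y <- DB 1) \sw_(u, v <- DB 1)
  (q a1 u * (q r v * q s x) * q a3 y : C^o)).
  apply: (sw_ext (W := C^o)) => r s.
  rewrite -!pair1B !pair_mulA sw_cmul sw_swap; apply: (sw_ext (W := C^o)) => x y.
  by apply: (sw_ext (W := C^o)) => u v; rewrite !mulrA.
transitivity (\sw_(x, y <- DB 1) \sw_(u, v <- DB 1) \sw_(r, s <- DA a2)
  (q a1 u * (q r v * q s x) * q a3 y : C^o)).
  rewrite sw_swap; apply: (sw_ext (W := C^o)) => x z; exact: sw_swap.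
apply: (sw_ext (W := C^o)) => x y; apply: (sw_ext (W := C^o)) => u v.
by rewrite pair_mulB sw_mul2l sw_mul2r.
Qed.

Lemma dual_S1 : SB 1 = 1.
Proof. by apply: (separating_eq sepB) => a; rewrite -pairS !pair1B (epsS HA). Qed.

Lemma dual_SM b c : SB (b * c) = SB c * SB b.
Proof.
apply: (separating_eq sepB) => a; rewrite -pairS !pair_mulB (DeltaS HA); last lin.
by apply: (sw_ext (W := C^o)) => x y; rewrite !pairS mulrC.
Qed.

Lemma dual_epsS b : eB (SB b) = eB b.
Proof. by rewrite -!pair1A -pairS (S1 HA). Qed.

Lemma dual_DeltaS b : DB (SB b) = tflip (tmap SB SB (DB b)).
Proof.
apply: sepBBeq => a a'; rewrite -pair_mulA -pairS (SM HA) pair_mulA.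
rewrite (sw_tflip (W := C^o)); last lin.
rewrite (sw_tmap (W := C^o)); last lin.
by apply: (sw_ext (W := C^o)) => x y; rewrite !pairS mulrC.
Qed.

(** The counital maps of the two sides are transposes of each other; this carries over the antipode
    axioms and regularity. *)
Lemma pair_eps_t a b : q a (eps_t DB eB b) = q (eps_t DA eA a) b.
Proof.
have qa := qlin.2 a; have qb := qlin.1 b.
rewrite !eps_tE // (lin_swE _ _ qa) (lin_swE _ _ qb).
transitivity (\sw_(x, y <- DB 1) \sw_(u, v <- DA 1) (q u x * q v b * q a y : C^o)).
  apply: (sw_ext (W := C^o)) => x y.
  by rewrite (linZ _ _ qa) -pair1A pair_mulB -sw_mul2r.
rewrite sw_swap; apply: (sw_ext (W := C^o)) => u v.
rewrite (linZ _ _ qb) -pair1B pair_mulA /GRing.scale /= sw_mul2r.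
by apply: (sw_ext (W := C^o)) => x y; rewrite mulrAC.
Qed.

Lemma pair_eps_s a b : q a (eps_s DB eB b) = q (eps_s DA eA a) b.
Proof.
have qa := qlin.2 a; have qb := qlin.1 b.
rewrite !eps_sE // (lin_swE _ _ qa) (lin_swE _ _ qb).
transitivity (\sw_(x, y <- DB 1) \sw_(u, v <- DA 1) (q u b * q v y * q a x : C^o)).
  apply: (sw_ext (W := C^o)) => x y.
  by rewrite (linZ _ _ qa) -pair1A pair_mulB -sw_mul2r.
rewrite sw_swap; apply: (sw_ext (W := C^o)) => u v.
rewrite (linZ _ _ qb) -pair1B pair_mulA /GRing.scale /= sw_mul2r.
by apply: (sw_ext (W := C^o)) => x y; rewrite -mulrA mulrC (mulrC (q v y)).
Qed.

Lemma dual_mulS b : \sw_(x, y <- DB b) (x * SB y) = eps_t DB eB b.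
Proof.
apply: (separating_eq sepB) => a; have qa := qlin.2 a; have qb := qlin.1 b.
rewrite pair_eps_t -(mulS_eps_t HA) (lin_swE _ _ qa) (lin_swE _ _ qb).
transitivity (\sw_(x, y <- DB b) \sw_(u, v <- DA a) (q u x * q v (SB y) : C^o)).
  by apply: (sw_ext (W := C^o)) => x y; rewrite pair_mulB.
rewrite sw_swap; apply: (sw_ext (W := C^o)) => u v; rewrite pair_mulA.
by apply: (sw_ext (W := C^o)) => x y; rewrite pairS.
Qed.

Lemma dual_Smul b : \sw_(x, y <- DB b) (SB x * y) = eps_s DB eB b.
Proof.
apply: (separating_eq sepB) => a; have qa := qlin.2 a; have qb := qlin.1 b.
rewrite pair_eps_s -(Smul_eps_s HA) (lin_swE _ _ qa) (lin_swE _ _ qb).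
transitivity (\sw_(x, y <- DB b) \sw_(u, v <- DA a) (q u (SB x) * q v y : C^o)).
  by apply: (sw_ext (W := C^o)) => x y; rewrite pair_mulB.
rewrite sw_swap; apply: (sw_ext (W := C^o)) => u v; rewrite pair_mulA.
by apply: (sw_ext (W := C^o)) => x y; rewrite pairS.
Qed.

Lemma dual_SmulmulS b :
  tcontract (fun M z => \sw_(x, y <- M) (SB x * y * SB z)) (tmap DB id (DB b)) = SB b.
Proof.
apply: (separating_eq sepB) => a; have qa := qlin.2 a; have qb := qlin.1 b.
rewrite sw_sw (lin_swE _ _ qa) -pairS -(SmulmulS HA) (lin_swE _ _ qb).
transitivity (\sw_(x, z <- DB b) \sw_(u, v <- DB x) \sw_(r, t <- DA a) \sw_(p, s <- DA r)
    (q (SA p) u * q s v * q (SA t) z : C^o)).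
  apply: (sw_ext (W := C^o)) => x z; rewrite sw_tens; last lin.
  rewrite (lin_swE _ _ qa); apply: (sw_ext (W := C^o)) => u v.
  rewrite pair_mulB; apply: (sw_ext (W := C^o)) => r t.
  rewrite pair_mulB sw_mul2r; apply: (sw_ext (W := C^o)) => p s.
  by rewrite !pairS.
rewrite sw_swap22; apply: (sw_ext (W := C^o)) => r t.
rewrite (lin_swE _ _ qb); apply: (sw_ext (W := C^o)) => p s.
rewrite pair_mulA; apply: (sw_ext (W := C^o)) => x z.
by rewrite pair_mulA sw_mul2r.
Qed.

Lemma dual_CQG : is_CQG starB DB eB SB.
Proof.
split=> //.
- by split; [exact: DBl | exact: dual_coassoc | exact: dual_DeltaM | exact: dual_Delta_star].
- split; [exact: eBl | exact: dual_counitl | exact: dual_counitr | exact: dual_epsM12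
    | exact: dual_epsM21].
- split; [exact: dual_weak_unit_lr | exact: dual_weak_unit_rl].
split; [exact: SBl | split; [exact: dual_S1 | exact: dual_SM]
  | split; [exact: dual_DeltaS | exact: dual_epsS]
  | split; [exact: dual_mulS | exact: dual_Smul] | exact: dual_SmulmulS].
Qed.

(** [S^2] commutes with the counital maps, and all of these are transposed by the pairing, so
    triviality of [S^2] on their images passes to [B]. *)
Lemma dual_regular : is_regular DA eA SA -> is_regular DB eB SB.
Proof.
move=> [rt rs]; split=> b [g ->]; apply: (separating_eq sepB) => a.
  rewrite -!pairS !pair_eps_t -(S_eps_s HA) -(S_eps_t HA) rt //.
  by exists a.
rewrite -!pairS !pair_eps_s -(S_eps_t HA) -(S_eps_s HA) rs //.
by exists a.
Qed.

End Duality.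

(** * Linear and bilinear forms represented through a nondegenerate pairing *)

Section Representation.
Variables (C : numClosedFieldType) (U V : vectType C) (q : U -> V -> C).
Hypothesis ql : bilinear_map (q : U -> V -> C^o).
Hypothesis q0 : forall u, (forall v, q u v = 0) -> u = 0.

Let gram : 'T[C]_(U, V) := \matrix_(i, j) q (be i) (be j).

Let gram_free : row_free gram.
Proof.
apply: inj_row_free => v v0; pose u : U := \sum_i v 0 i *: be i.
have u0 : u = 0.
  apply: q0 => w; rewrite (vec_be w) (lin_sum _ _ _ (ql.2 u)) big1 // => j _.
  rewrite (linZ _ _ (ql.2 u)) (lin_sum _ _ _ (ql.1 _)).
  have := congr1 (fun M : 'rV_(bdim V) => M 0 j) v0; rewrite !mxE => E.
  rewrite -[RHS](scaler0 _ (crd j w)) -[X in _ = _ *: X]E; congr (_ *: _).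
  by apply: eq_bigr => i _; rewrite (linZ _ _ (ql.1 _)) mxE.
apply/rowP => i; rewrite mxE -[RHS](lin0 (crd_lin i)) -u0 (lin_sum _ _ _ (crd_lin i)).
rewrite (bigD1 i) //= (linZ _ _ (crd_lin i)) crd_be eqxx big1 => [|j ij].
  by rewrite /GRing.scale /= mulr1 addr0.
by rewrite (linZ _ _ (crd_lin i)) crd_be eq_sym (negPf ij) /GRing.scale /= mulr0.
Qed.

(** With [G] the Gram matrix, this turns representing a bilinear form by [Y] into solving
    [G Y G^T = M]. *)
Let sw_gram (X : 'T[C]_(U, U)) (Y : 'T[C]_(V, V)) :
  tpair q X Y = \sum_i \sum_j X i j * (gram *m Y *m gram^T) i j.
Proof.
apply: eq_bigr => i _; apply: eq_bigr => j _.
rewrite mxE mulr_sumr exchange_big; apply: eq_bigr => l _.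
rewrite !mxE mulr_suml mulr_sumr; apply: eq_bigr => k _.
by rewrite !mxE -!mulrA; congr (_ * _); rewrite mulrCA !mulrA.
Qed.

(** A right inverse of the Gram matrix gives the coordinates of [v]. The sigma type lets the witness
    be projected out, so that maps into [V] can be defined from it. *)
Lemma represent (f : U -> C) : is_linear (V := C^o) f -> {v : V | forall u, q u v = f u}.
Proof.
move=> fl; pose w : 'cV[C]_ (bdim V) := pinvmx gram *m \col_i f (be i).
exists (\sum_j w j 0 *: be j) => u.
rewrite (vec_be u) (lin_sum _ _ _ fl) (lin_sum _ _ _ (ql.1 _)); apply: eq_bigr => i _.
rewrite (linZ _ _ fl) (linZ _ _ (ql.1 _)); apply: (congr1 (fun t => crd i u * t)).
rewrite (lin_sum _ _ _ (ql.2 _)).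
have := congr1 (fun M : 'cV_(bdim U) => M i 0) (mulmxA gram (pinvmx gram) (\col_i f (be i))).
rewrite mulmxVp // mul1mx [RHS]mxE => <-; rewrite [RHS]mxE; apply: eq_bigr => j _.
by rewrite (linZ _ _ (ql.2 _)) [gram i j]mxE; apply: mulrC.
Qed.

Lemma represent_tens (g : U -> U -> C) : bilinear_map (W := C^o) g ->
  {Y : 'T[C]_(V, V) | forall u u', tpair q (tens u u') Y = g u u'}.
Proof.
move=> gl; pose M : 'T[C]_(U, U) := \matrix_(i, j) g (be i) (be j).
move: (pinvmx gram) (mulmxVp gram_free) => P gP.
exists (P *m M *m P^T) => u u'.
rewrite sw_gram !mulmxA gP mul1mx -mulmxA -trmx_mul gP trmx1 mulmx1.
rewrite -[RHS](sw_tens (W := C^o) _ _ gl).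
by apply: eq_bigr => i _; apply: eq_bigr => j _; rewrite !mxE.
Qed.

End Representation.

(** * Duality for the deformed structure *)

Section DualDeformation.
Variables (C : numClosedFieldType) (A B : falgType C).
Variables (starA : A -> A) (DA : A -> 'T[C]_(A, A)) (eA : A -> C) (SA : A -> A).
Variables (starB : B -> B) (DB : B -> 'T[C]_(B, B)) (eB : B -> C) (SB : B -> B).
Variable p : A -> B -> C.
Variable k : A.
Hypothesis HA : is_CQG starA DA eA SA.
Hypothesis starB_fd : is_fdCstar starB.
Hypothesis Hp : is_dual_pair starA DA eA SA starB DB eB SB p.
Hypothesis kAt : in_At DA eA k.
Hypothesis star_k : starA k = k.
Hypothesis ku : k \is a GRing.unit.
Hypothesis k2 : k * k = modular_elt DA SA.

Local Notation l := (k^-1).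
Local Notation K := (SA k).
Local Notation L := (SA l).
Local Notation D' := (def_Delta DA k).
Local Notation e' := (def_eps eA SA k).
Local Notation S' := (def_S SA k).
Local Notation p' := (fun a b => p (k * a * SA k) b).

Let S2k : SA K = k. Proof. exact: (S2k HA kAt ku k2). Qed.
Let KL : K * L = 1. Proof. exact: (KL HA ku). Qed.
Let LK : L * K = 1. Proof. exact: (LK HA ku). Qed.
Let S2l : SA L = l. Proof. exact: (S2l HA kAt ku k2). Qed.
Let lK : l * K = K * l. Proof. exact: (lK HA kAt ku). Qed.

Let SAl := S_lin HA.
Let plin : bilinear_map (p : A -> B -> C^o).
Proof. exact: pairing_bilin Hp. Qed.
Let p'lin : bilinear_map (p' : A -> B -> C^o).
Proof. by lin. Qed.

Let star_K : starA K = K.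
Proof.
have S_inj : injective SA.
  move=> a a' E; rewrite -(star_S_starA HA starB_fd Hp a) E.
  exact: (star_S_starA HA starB_fd Hp a').
apply: S_inj; rewrite S2k -[LHS](starK HA) -[RHS]star_k; congr starA.
exact: (star_S_starA HA starB_fd Hp k).
Qed.

Let p'l0 a : (forall b, p' a b = 0) -> a = 0.
Proof.
case: Hp => _ [p0 _] _ _ _ /p0 E.
by rewrite -[a](mulKr ku) -[k * a]mulr1 -KL mulrA E mul0r mulr0.
Qed.

Let p'r0 b : (forall a, p' a b = 0) -> b = 0.
Proof.
case: Hp => _ [_ p0] _ _ _ E; apply: p0 => a.
by rewrite -(E (l * a * L)) -!mulrA LK mulr1 mulVKr.
Qed.

(** [Delta(k a K) = (k # 1)Delta(a)(1 # K)], and writing [K = k l K] on the second leg lets that [k]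
    slide to the first as [K]. This yields [k x K # y l K], the two arguments that [p'] makes out of
    the legs of [D']. *)
Let p'_mulB a b c : p' a (b * c) = tpair p' (D' a) (tens b c).
Proof.
rewrite tpairE (pair_mulB Hp).
transitivity (\sw_(x, y <- D' a) (p (k * x * K) b * p (k * y * K) c : C^o)); last first.
  by apply: (sw_ext (W := C^o)) => x y; rewrite (sw_tens (W := C^o)) //; lin.
rewrite (sw_def_Delta DA k (W := C^o)); last lin.
transitivity (\sw_(x, y <- mulT (DA a) (tens 1 K)) (p (k * x) b * p y c : C^o)).
  rewrite (sw_tensr (W := C^o)); last lin.
  rewrite (K_source HA kAt _).2 (sw_tensr (W := C^o)); last lin.
  rewrite (k_target HA kAt _).1 (sw_tensl (W := C^o)); last lin.
  by apply: (sw_ext (W := C^o)) => x y; rewrite !mulr1 mul1r.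
have -> : mulT (DA a) (tens 1 K) = mulT (mulT (DA a) (tens K 1)) (tens 1 (l * K)).
  by rewrite (K_slider HA kAt ku k2) -mulTA mulT_tens mulr1 mulVKr.
rewrite !(sw_tensr (W := C^o)); try lin.
apply: (sw_ext (W := C^o)) => x y.
by rewrite !mulr1 -!mulrA mulVKr.
Qed.

Lemma dual_deformation :
  exists (DB' : B -> 'T[C]_(B, B)) (eB' : B -> C) (SB' : B -> B),
  [/\ is_CQG starB DB' eB' SB', is_regular DB' eB' SB' &
      is_dual_pair starA D' e' S' starB DB' eB' SB' p'].
Proof.
have gl b : bilinear_map (W := C^o) (fun a a' => p' (a * a') b) by lin.
have fl b : is_linear (V := C^o) (fun a => p' (S' a) b) by rewrite /def_S; lin.
(* Coproduct and antipode of the new dual are forced by the pairing axioms, which here serve as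
   their definition for each [b]. *)
pose DB' b := sval (represent_tens p'lin p'l0 (gl b)).
pose SB' b := sval (represent p'lin p'l0 (fl b)).
have p'_mulA a a' b : p' (a * a') b = tpair p' (tens a a') (DB' b).
  by rewrite /DB'; case: represent_tens => Y /= ->.
have p'_S a b : p' (S' a) b = p' a (SB' b).
  by rewrite /SB'; case: represent => v /= ->.
have p'_star a b : p' (starA a) b = (p' a (starB (SB' b)))^*.
  cbv beta; rewrite (pair_starB HA starB_fd Hp) conjCK.
  (* Brought to the shape [k c K] to become an argument of [p']; then [SB'] moves across as [S'],
     and [S'(c)] simplifies to [starA a]. *)
  have -> : starA (SA (k * a * K)) = k * (l * (K * starA (SA a) * k) * L) * K.
    rewrite !(SM HA) S2k !(starM HA) star_K star_k -!mulrA mulVKr // LK mulr1.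
    by [].
  rewrite -p'_S; congr (p _ b).
  have E : SA (starA (SA a)) = starA a.
    by rewrite -[LHS](starK HA) (star_S_starA HA starB_fd Hp).
  have lKA c : l * (K * c) = K * (l * c) by rewrite !mulrA lK.
  have LKA c : L * (K * c) = c by rewrite mulrA LK mul1r.
  by rewrite /def_S !(SM HA) S2k S2l E -!mulrA mulVKr // LKA lKA LKA mulVKr.
have Hp' : is_dual_pair starA D' e' S' starB DB' (p' 1) SB' p'.
  split; [by case: p'lin | by [] | by [] | | by []].
  by split=> // a; cbv beta; rewrite (pair1B Hp).
exists DB', (p' 1), SB'; split=> //.
  exact: (dual_CQG (def_CQG HA kAt star_k ku k2) starB_fd Hp').
apply: (dual_regular (def_CQG HA kAt star_k ku k2) Hp').
exact: (def_regular HA kAt ku k2).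
Qed.
End DualDeformation.

Theorem theorem7p3 (R : realType) (A B : falgType R[i])
  (starA : A -> A) (DA : A -> 'T[R[i]]_(A, A)) (eA : A -> R[i]) (SA : A -> A)
  (starB : B -> B) (DB : B -> 'T[R[i]]_(B, B)) (eB : B -> R[i]) (SB : B -> B)
  (p : A -> B -> R[i]) (k : A) :
  is_CQG starA DA eA SA ->
  is_CQG starB DB eB SB ->
  is_dual_pair starA DA eA SA starB DB eB SB p ->
  (* k is the positive invertible element of A_t with k^2 = 1_(2) S(1_(1)) *)
  in_At DA eA k ->
  (exists x : A, k = starA x * x) ->
  k \is a GRing.unit ->
  k * k = tcontract (fun x y => y * SA x) (DA 1) ->
  [/\ is_CQG starA (def_Delta DA k) (def_eps eA SA k) (def_S SA k),
      is_regular (def_Delta DA k) (def_eps eA SA k) (def_S SA k),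
      (forall a, eA (k * a * SA k) = eA (SA k * a * k)) &
      exists (DB' : B -> 'T[R[i]]_(B, B)) (eB' : B -> R[i]) (SB' : B -> B),
        [/\ is_CQG starB DB' eB' SB',
            is_regular DB' eB' SB' &
            is_dual_pair starA (def_Delta DA k) (def_eps eA SA k) (def_S SA k)
                         starB DB' eB' SB' (fun a b => p (k * a * SA k) b)]].
Proof.
move=> HA HB Hp kAt [x kx] ku k2.
have star_k : starA k = k by rewrite kx (starM HA) (starK HA).
split; first exact: def_CQG.
- exact: (def_regular HA kAt ku k2).
- exact: (def_eps_sym HA kAt ku k2).
apply: (dual_deformation HA _ Hp) => //.
by case: HB.
Qed.
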